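(* Let $u\le v$ in the (strong) Bruhat order of $S_n$, and let $[u,v]$ be the corresponding Bruhat interval. The twisted Bruhat interval polytope $\tilde{P}_{[u,v]}$ is an MV polytope if and only if $\operatorname{proj}_k([u,v])=[\operatorname{proj}_k(u),\operatorname{proj}_k(v)]$ for all $k\in[n]$, where the right-hand side is an interval in the Gale order on $\binom{[n]}{k}$.
   Context: For an interval $[u,v]$ in the Bruhat order of $S_n$, the twisted Bruhat interval polytope is $$\tilde{P}_{[u,v]}=\operatorname{conv}\bigl((n+1-w^{-1}(1),\,n+1-w^{-1}(2),\dots,n+1-w^{-1}(n)) : w\in[u,v]\bigr)\subseteq\mathbb{R}^n.$$ For $k\in[n]$, $\operatorname{proj}_k:S_n\to\binom{[n]}{k}$ is $\operatorname{proj}_k(w)=\{w(1),\dots,w(k)\}$. The Gale order on $k$-element subsets of $[n]$: for $A=\{a_1<\dots<a_k\}$ and $B=\{b_1<\dots<b_k\}$, $A\le B$ iff $a_i\le b_i$ for all $i$; $[A,B]=\{R\in\binom{[n]}{k}:A\le R\le B\}$. A generalized permutahedron on $[n]$ is a polytope $P\subseteq\mathbb{R}^n$ such that every edge of $P$ is parallel to a vector $e_i-e_j$ with $i\neq j$ (points are allowed), where $e_1,\dots,e_n$ is the standard basis. It is a lattice generalized permutahedron if all its vertices lie in $\mathbb{Z}^n$. Its supermodular function is $\mu^P(S)=\min_{x\in P}\sum_{i\in S}x_i$ for $S\subseteq[n]$. A lattice generalized permutahedron $P$ is a Mirković–Vilonen (MV) polytope on $[n]$ if for all $S\subseteq[n]$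 and all $a<b<c$ in $[n]\setminus S$, $$\mu^P(S\cup\{b\})+\mu^P(S\cup\{a,c\})=\min\bigl(\mu^P(S\cup\{a\})+\mu^P(S\cup\{b,c\}),\ \mu^P(S\cup\{a,b\})+\mu^P(S\cup\{c\})\bigr).$$ *)

(* Defs.v *)
From mathcomp Require Import all_boot all_order all_algebra all_fingroup.
From mathcomp Require Import boolp classical_sets cardinality reals convex.

Set Implicit Arguments.
Unset Strict Implicit.
Unset Printing Implicit Defensive.

Import Order.TTheory GRing.Theory Num.Theory.

(* The indices 1, ..., n are encoded as 0, ..., n - 1 in 'I_n, for positions,
   values and coordinates alike. *)

Section Combinatorics.
Variable n : nat.
Implicit Types (u v w : 'S_n) (A B S : {set 'I_n}).

(* The Coxeter length of w, computed as its number of inversions. *)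
Definition perm_length w : nat :=
  #|[set p : 'I_n * 'I_n | (p.1 < p.2) && (w p.2 < w p.1)]|.

(* In the one-line notation, (tperm i j * w)%g is w with the entries in
   positions i and j exchanged, since perm products compose left to right. *)
Definition bruhat_step : rel 'S_n := fun u v =>
  [exists i, exists j, v == (tperm i j * u)%g]
    && (perm_length u < perm_length v).

Definition bruhat_le : rel 'S_n := connect bruhat_step.

Definition bruhat_interval u v : {set 'S_n} :=
  [set w | bruhat_le u w && bruhat_le w v].

Definition proj (k : nat) w : {set 'I_n} := [set w i | i : 'I_n & i < k].

(* enum A lists A in increasing order; all2 forces #|A| = #|B|. *)
Definition gale_le A B : bool :=
  all2 (fun a b : 'I_n => a <= b) (enum A) (enum B).

Definition gale_interval (k : nat) A B : {set {set 'I_n}} :=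
  [set S : {set 'I_n} | [&& #|S| == k, gale_le A S & gale_le S B]].

End Combinatorics.

Section Polytopes.
Local Open Scope classical_set_scope.
Local Open Scope ring_scope.
Variables (R : realType) (n : nat).
Implicit Types (P F A : set 'rV[R]_n) (x y c : 'rV[R]_n) (S : {set 'I_n}).

Definition hull A : set 'rV[R]_n := smallest (@convex_set R 'rV[R]_n) A.

Definition is_polytope P : Prop :=
  exists A, [/\ finite_set A, A !=set0 & P = hull A].

Definition dot c x : R := \sum_i c 0 i * x 0 i.

(* Nonempty faces; c = 0 gives the face P itself. *)
Definition is_face P F : Prop :=
  F !=set0 /\
  exists c, F = [set x | P x /\ forall y, P y -> dot c x <= dot c y].

(* The largest d such that F contains d + 1 affinely independent points
   x, x + row 0 M, ..., x + row (d - 1) M. *)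
Definition aff_dim F : nat :=
  \max_(d < n.+1 | `[< exists x (M : 'M[R]_(d, n)),
     [/\ F x, forall i, F (x + row i M) & row_free M] >]) d.

Definition is_vertex P x : Prop := is_face P [set x].

Definition is_edge P F : Prop := is_face P F /\ aff_dim F = 1%N.

Definition parallel_to F (d : 'rV[R]_n) : Prop :=
  forall x y, F x -> F y -> exists t : R, y - x = t *: d.

Definition generalized_permutahedron P : Prop :=
  is_polytope P /\
  forall F, is_edge P F ->
    exists i j : 'I_n, i != j /\ parallel_to F (delta_mx 0 i - delta_mx 0 j).

Definition lattice_generalized_permutahedron P : Prop :=
  generalized_permutahedron P /\
  forall x, is_vertex P x -> forall i, x 0 i \is a Num.int.

(* The default 0 of xget is returned only if there is no minimum, which does
   not happen when P is a (nonempty) polytope. *)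
Definition mu P S : R :=
  let values := [set \sum_(i in S) x 0 i | x in P] in
  xget 0 (values `&` lbound values).

Definition MV_polytope P : Prop :=
  lattice_generalized_permutahedron P /\
  forall S (a b c : 'I_n),
    a \notin S -> b \notin S -> c \notin S -> (a < b < c)%N ->
    mu P (b |: S) + mu P (a |: (c |: S)) =
    Num.min (mu P (a |: S) + mu P (b |: (c |: S)))
            (mu P (a |: (b |: S)) + mu P (c |: S)).

(* The i-th coordinate is n + 1 - w^-1(i), where w^-1(i) is the 1-based
   position (w^-1 i).+1. *)
Definition twisted_point (w : 'S_n) : 'rV[R]_n :=
  \row_i (n.+1%:R - ((w^-1)%g i).+1%:R).

Definition twisted_bruhat_interval_polytope (u v : 'S_n) : set 'rV[R]_n :=
  hull [set twisted_point w | w in [set` bruhat_interval u v]].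

End Polytopes.

Arguments twisted_point R {n} w.
Arguments twisted_bruhat_interval_polytope R {n} u v.

(* Main.v *)
Require Import Defs.
From mathcomp Require Import boolp classical_sets cardinality convex.
From mathcomp Require Import interval_inference.
From mathcomp Require Import all_boot all_order all_algebra all_fingroup.
From mathcomp Require Import reals.
From mathcomp Require Import zify ring lra.

(** The coordinate of the twisted point of w at i is the number of k with
    i in proj_k w, so the polytope is governed by the sets M_k = proj_k [u,v].
    The pivot is the property [greedy]: for every linear order of the values,
    one element of [u,v] minimizes |S n proj_k w| simultaneously for all k and
    all initial sets S of the order.

    A generalized permutahedron is greedy, because an edge joins two
    permutations differing by an exchange of two values, and walking along
    improving edges improves all the numbers |S n proj_k w|.  Conversely a
    greedy set spans a lattice generalized permutahedron.  If all M_k are Gale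
    intervals, consecutive M_k satisfy a quotient exchange property, so their
    weight-optimal members form a flag, which lies in [u,v] by the tableau
    criterion; hence [u,v] is greedy.

    For a greedy set and a < b < c outside S, the six orders that put S first,
    then a, b, c in any order, give six vertices that differ only in the
    coordinates a, b, c.  The MV relation says that the width of this hexagon in
    direction b is the larger of its widths in directions a and c.  This holds
    for all S, a, b, c iff every M_k satisfies: U+a, U+c in M_k imply
    U+b in M_k, and U+a+b, U+b+c in M_k imply U+a+c in M_k.  Given the exchange
    axiom, these two closure conditions characterize Gale intervals. *)

Set Implicit Arguments.
Unset Strict Implicit.
Unset Printing Implicit Defensive.

(** * The Gale order *)

Section GaleOrder.

(** Faces are cut out by arbitrary real functionals, whereas [greedy] only speaks of linear orders
    of the values. Abel summation over the level sets of a functional, with ties broken as needed,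
    translates between the two. All twisted points have the same coordinates up to order, so they
    lie on one sphere: each is the unique maximizer among them of its own functional, and no three
    are collinear. This replaces a theory of face lattices: an edge carries exactly two of the
    points, and edges are found by perturbing functionals. A minimum of [wt] controls only a sum
    over [k], while the closure conditions concern a single M_k; hence minimality is required at
    every level at once ([kmin]). The Gale and Bruhat orders enter only through the counts [cnt],
    where both become pointwise inequalities. *)

Lemma path_count_lt0 (T : Type) (f : T -> nat) x s j :
  path (fun x y => f x < f y) x s -> j <= f x ->
  count (fun z => f z < j) s = 0.
Proof.
elim: s x => //= y s IHs x /andP[fxy ys] jx.
by rewrite (IHs y ys) ?(leq_trans jx (ltnW fxy)) // ltnNge (leq_trans jx (ltnW fxy)).
Qed.

(** Counts are additive, so in this form the Gale order can be handled by linear arithmetic. For the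
    converse, the threshold [(f y).+1] compares the heads, and thresholds up to [f y] count nothing
    in [t]. *)
Lemma sorted_all2_leqP (T : Type) (f : T -> nat) (s t : seq T) :
  sorted (fun x y => f x < f y) s -> sorted (fun x y => f x < f y) t ->
  all2 (fun x y => f x <= f y) s t <->
  size s = size t /\
  forall j, count (fun z => f z < j) t <= count (fun z => f z < j) s.
Proof.
elim: s t => [|x s IHs] [|y t] //=; [by split=> // -[] | by split=> // -[] |].
move=> xs yt; have IH := IHs t (path_sorted xs) (path_sorted yt).
split=> [/andP[xy /IH[-> st]]|[[/= sz] st]].
  by split=> // j; apply: leq_add (st j); case: ltnP => // yj;
    rewrite (leq_ltn_trans xy).
have xy : f x <= f y.
  have := st (f y).+1; rewrite ltnS leqnn; case: ltnP => // yx.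
  by rewrite (path_count_lt0 xs).
rewrite xy; apply/IH; split=> // j.
have [jy|yj] := leqP j (f y); first by rewrite (path_count_lt0 yt).
by have := st j; rewrite yj (leq_ltn_trans xy yj) leq_add2l.
Qed.

Variable n : nat.
Implicit Types A B : {set 'I_n}.

Definition cnt A (j : nat) : nat := #|[set i in A | i < j]|.

Lemma cntE A j : cnt A j = count (fun i : 'I_n => i < j) (enum A).
Proof.
rewrite /cnt -sum1_card -sum1_count big_enum_cond /=.
by apply: eq_bigl => i; rewrite inE.
Qed.

Lemma sorted_enum A : sorted (fun i j : 'I_n => i < j) (enum A).
Proof.
have tr : transitive (fun i j : 'I_n => i < j) by move=> ? ? ?; apply: ltn_trans.
rewrite /enum_mem -enumT; apply: sorted_filter => //.
by have := iota_ltn_sorted 0 n; rewrite -val_enum_ord sorted_map.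
Qed.

Lemma gale_leP A B :
  gale_le A B <-> #|A| = #|B| /\ forall j, cnt B j <= cnt A j.
Proof.
rewrite /gale_le (sorted_all2_leqP (sorted_enum A) (sorted_enum B)) -!cardE.
by split=> -[-> AB]; split=> // j; have := AB j; rewrite !cntE.
Qed.

Lemma mem_gale_interval k A B (S : {set 'I_n}) : #|A| = k -> #|B| = k ->
  S \in gale_interval k A B <->
  #|S| = k /\ forall j, cnt B j <= cnt S j <= cnt A j.
Proof.
move=> Ak Bk; rewrite inE; split.
  move=> /and3P[/eqP Sk /gale_leP[_ AS] /gale_leP[_ SB]]; split=> // j.
  by rewrite SB AS.
move=> [Sk ASB]; apply/and3P; split; first exact/eqP.
  by apply/gale_leP; rewrite Ak Sk; split=> // j; case/andP: (ASB j).
by apply/gale_leP; rewrite Bk Sk; split=> // j; case/andP: (ASB j).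
Qed.

Lemma cnt_sum A j : cnt A j = \sum_(i in A) (i < j).
Proof.
rewrite /cnt -sum1_card big_mkcond [RHS]big_mkcond; apply: eq_bigr => i _.
by rewrite inE; case: (i \in A) => //=; case: ltnP.
Qed.

Lemma cntU1 A x j : x \notin A -> cnt (x |: A) j = (x < j) + cnt A j.
Proof. by move=> xA; rewrite !cnt_sum big_setU1. Qed.

Lemma cntD1 A x j : x \in A -> cnt A j = (x < j) + cnt (A :\ x) j.
Proof. by move=> xA; rewrite !cnt_sum (big_setD1 x). Qed.

Lemma cnt0 A : cnt A 0 = 0.
Proof. by rewrite cnt_sum big1. Qed.

Lemma cnt_full A j : n <= j -> cnt A j = #|A|.
Proof.
move=> nj; apply: eq_card => i; rewrite inE.
by rewrite (leq_trans (ltn_ord i) nj) andbT.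
Qed.

Lemma cntS A (i : 'I_n) : cnt A i.+1 = (i \in A) + cnt A i.
Proof.
rewrite /cnt; have -> : [set j in A | j < i.+1] =
  if i \in A then i |: [set j in A | j < i] else [set j in A | j < i].
  apply/setP => j; rewrite (fun_if (fun X : {set 'I_n} => j \in X)) !inE ltnS.
  rewrite leq_eqVlt val_eqE; case: (eqVneq j i) => [->|/=]; last by case: ifP.
  by rewrite ltnn andbF; case: ifP; rewrite ?andbT.
case: ifP => // _; by rewrite cardsU1 !inE ltnn andbF.
Qed.

End GaleOrder.

(** * The tableau criterion for the Bruhat order *)

Section TableauCriterion.
Import GroupScope.
Variable n : nat.
Implicit Types (u v w : 'S_n) (p q i : 'I_n) (k j : nat).

Lemma mem_proj w k i : (i \in proj k w) = (w^-1 i < k)%N.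
Proof.
apply/imsetP/idP => [[p]|wk]; first by rewrite inE => pk ->; rewrite permK.
by exists (w^-1 i); rewrite ?inE ?permKV.
Qed.

Lemma cnt_proj w k j : cnt (proj k w) j = (\sum_(p < n) (p < k) * (w p < j))%N.
Proof.
rewrite cnt_sum big_imset /=; last by move=> ? ? _ _; apply: perm_inj.
rewrite big_mkcond; apply: eq_bigr => p _.
by rewrite inE; case: ifP; rewrite ?mul1n ?mul0n.
Qed.

Lemma card_proj w k : k <= n -> #|proj k w| = k.
Proof.
move=> kn; rewrite -(cnt_full _ (leqnn n)) cnt_proj.
rewrite (eq_bigr (fun p : 'I_n => if p < k then 1 else 0)%N); last first.
  by move=> p _; rewrite ltn_ord muln1; case: ltnP.
by rewrite -big_mkcond -(big_ord_widen n (fun=> 1%N)) // sum1_card card_ord.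
Qed.

Lemma cnt_proj_tperm u p q k j : p < q -> u p < u q ->
  cnt (proj k u) j =
    (cnt (proj k (tperm p q * u)) j + [&& p < k, k <= q, u p < j & j <= u q])%N.
Proof.
move=> pq upq; rewrite !cnt_proj.
have qp : q != p by apply: contraTneq pq => ->; rewrite ltnn.
rewrite (bigD1 p) // [in RHS](bigD1 p) //= (bigD1 q) // [in RHS](bigD1 q) //=.
rewrite !permM tpermL tpermR.
under [in RHS]eq_bigr => i /andP[ip iq] do rewrite permM tpermD 1?eq_sym //.
move: (\sum_(i < n | _) _)%N => S; rewrite !mulnb; lia.
Qed.

(** The map [f] injects the inversions of [u] into those of [t * u]: it applies [t] to both
    positions when this keeps their order, and otherwise leaves the pair alone. The new inversion
    [(p, q)] is not in its image. *)
Lemma perm_length_tperm u p q : p < q -> u p < u q ->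
  perm_length u < perm_length (tperm p q * u).
Proof.
move=> pq upq; set t := tperm p q.
have tv r : (t r = q /\ r = p) \/ (t r = p /\ r = q) \/ [/\ t r = r, r != p & r != q].
  rewrite /t; case: tpermP => [->|->|/eqP rp /eqP rq]; [by left|by right; left|].
  by right; right.
pose inv w := [set r : 'I_n * 'I_n | (r.1 < r.2) && (w r.2 < w r.1)].
pose f (r : 'I_n * 'I_n) := if t r.1 < t r.2 then (t r.1, t r.2) else r.
have fI : {in inv u &, injective f}.
  move=> [a b] [c d]; rewrite !inE /f /= => /andP[ab _] /andP[cd _].
  case: ifP => tab; case: ifP => tcd.
  - by move=> [/perm_inj -> /perm_inj ->].
  - by move=> [ac bd]; move: tcd; rewrite -ac -bd /t !tpermK ab.
  - by move=> [ac bd]; move: tab; rewrite ac bd /t !tpermK cd.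
  - by [].
rewrite /perm_length -/(inv u) -/(inv (t * u)) -(card_in_imset fI).
apply: proper_card; apply/properP; split.
  apply/subsetP => _ /imsetP[[a b] + ->]; rewrite !inE /f /= => /andP[ab uab].
  case: ifP => tab /=; first by rewrite tab !permM /t !tpermK.
  rewrite ab /= !permM; move: tab.
  case: (tv a) => [[-> ea]|[[-> ea]|[-> ap aq]]];
    case: (tv b) => [[-> eb]|[[-> eb]|[-> bp bq]]] tab //; subst; lia.
exists (p, q); first by rewrite inE /= pq !permM /t tpermL tpermR.
apply/negP => /imsetP[[a b] + pqE]; rewrite inE /= => /andP[ab uab].
move: pqE; rewrite /f /=; case: ifP => tab [pE qE].
  have /perm_inj aq : t a = t q by rewrite -pE /t tpermR.
  have /perm_inj bp : t b = t p by rewrite -qE /t tpermL.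
  by move: ab; rewrite aq bp ltnNge (ltnW pq).
by move: uab; rewrite -pE -qE ltnNge (ltnW upq).
Qed.

(** A step increases the length, so the exchanged entries of [u] form an ascent: otherwise
    [perm_length_tperm], applied to [v], would make [u] the longer one. *)
Lemma bruhat_stepP u v :
  bruhat_step u v -> exists p q, [/\ p < q, u p < u q & v = tperm p q * u].
Proof.
move=> /andP[/existsP[i /existsP[j /eqP vE]] uv].
wlog ij : i j vE / i < j => [H|].
  have [ij|ji|ij] := ltngtP i j; first exact: (H i j).
    by apply: (H j i) => //; rewrite tpermC.
  by move: uv; rewrite vE (val_inj ij) tperm1 mul1g ltnn.
exists i, j; split=> //.
have [//|uji|/val_inj/perm_inj uij] := ltngtP (u i) (u j); last first.
  by rewrite uij ltnn in ij.
have := @perm_length_tperm v i j ij.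
rewrite vE mulgA tperm2 mul1g -vE; rewrite vE !permM tpermL tpermR => /(_ uji).
by rewrite -vE ltnNge (ltnW uv).
Qed.

Lemma bruhat_le_cnt u v : bruhat_le u v ->
  forall k j, cnt (proj k v) j <= cnt (proj k u) j.
Proof.
move=> /connectP[s us ->]; elim: s u us => //= w s IHs u /andP[uw ws] k j.
apply: leq_trans (IHs _ ws k j) _.
have [p [q [pq upq ->]]] := bruhat_stepP uw.
by rewrite (cnt_proj_tperm _ _ pq upq) leq_addr.
Qed.

(* Björner-Brenti, Theorem 2.1.5: at the first position p where u and v differ,
   exchange u p with the next entry of u lying in the interval ]u p, v p]. *)
Lemma cnt_bruhat_step u v : u != v ->
  (forall k j, cnt (proj k v) j <= cnt (proj k u) j) ->
  exists2 w, bruhat_step u w & forall k j, cnt (proj k v) j <= cnt (proj k w) j.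
Proof.
move=> neq_uv vu.
have [p0 p0P] : exists p, u p != v p.
  apply/existsP; apply: contraNT neq_uv; rewrite negb_exists => /forallP uv.
  by apply/eqP/permP => p; apply/eqP; rewrite -[_ == _]negbK.
have [p puv pmin] :=
  @arg_minnP _ p0 (fun p => u p != v p) (fun p : 'I_n => p : nat) p0P.
have before i : i < p -> u i = v i.
  by move=> ip; apply/eqP; apply: contraTT ip => /pmin; rewrite -leqNgt.
have ltp : u p < v p.
  have puv' : u p != v p :> nat by rewrite val_eqE.
  rewrite ltn_neqAle puv' /=; have := vu p.+1 (v p).+1.
  rewrite !cnt_proj (bigD1 p) // [X in _ <= X -> _](bigD1 p) //= !ltnS !leqnn !mul1n.
  rewrite [X in (_ + X)%N <= _ -> _](eq_bigr
    (fun i : 'I_n => (i < p.+1) * (u i < (v p).+1))%N).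
    by rewrite leq_add2r; case: (u p <= v p).
  move=> i ip; rewrite ltnS leq_eqVlt val_eqE (negPf ip) /=.
  by case: ltnP => // /before ->.
have q0P : (p < u^-1 (v p)) && (u p < u (u^-1 (v p)) <= v p).
  rewrite permKV leqnn ltp !andbT ltnNge; apply/negP => qp.
  have [/val_inj qp'|] := eqVneq (u^-1 (v p) : nat) p.
    by move: ltp; rewrite -{1}qp' permKV ltnn.
  rewrite neq_ltn => /orP[|]; last by rewrite ltnNge qp.
  move=> lt; have := before _ lt; rewrite permKV => /perm_inj qp'.
  by rewrite -qp' ltnn in lt.
have [q /and3P[pq upq uqp] qmin] := @arg_minnP _ (u^-1 (v p))
  (fun q => (p < q) && (u p < u q <= v p)) (fun q : 'I_n => q : nat) q0P.
exists (tperm p q * u).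
  rewrite /bruhat_step perm_length_tperm // andbT.
  by apply/existsP; exists p; apply/existsP; exists q.
move=> k j; have := cnt_proj_tperm k j pq upq.
case: and4P => [[pk kq upj juq] E|_]; last by rewrite addn0 => <-.
(* Here the exchange costs one, so [u] must exceed [v] strictly at the threshold [j]. The surplus
   comes from comparing with the threshold [(v p).+1]: no entry of [u] strictly between positions
   [p] and [q] lies in ]u p, v p], and position [p] supplies the extra unit. *)
rewrite -(leq_add2r true) -E -(leq_add2r (cnt (proj k u) (v p).+1)).
apply: leq_trans (leq_add (leqnn _) (vu k (v p).+1)).
have -> : true = (\sum_(i < n) (i == p))%N :> nat 
  by rewrite (bigD1 p) //= eqxx big1 // => i /negPf ->.
rewrite !cnt_proj -!big_split; apply: leq_sum => i _ /=.
rewrite !mulnb; have [ip|pi|/val_inj ->] := ltngtP i p.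
- by rewrite (before _ ip) -[i == p]val_eqE (ltn_eqF ip) addn0 addnC.
- rewrite -[i == p]val_eqE (gtn_eqF pi); case: (ltnP i k) => //= ik.
  by have := qmin i; rewrite pi /=; lia.
- by rewrite eqxx pk /=; lia.
Qed.

Lemma bruhat_leP u v :
  bruhat_le u v <-> forall k j, cnt (proj k v) j <= cnt (proj k u) j.
Proof.
split=> [|]; first exact: bruhat_le_cnt.
have bound w : perm_length w <= n * n.
  by rewrite /perm_length (leq_trans (max_card _)) // card_prod card_ord.
have [m] := ubnP (n * n - perm_length u)%N; elim: m u => // m IHm u um vu.
have [->|neq_uv] := eqVneq u v; first exact: connect0.
have [w uw vw] := cnt_bruhat_step neq_uv vu.
apply: connect_trans (connect1 uw) (IHm w _ vw).
by case/andP: uw => _ uw; have := bound w; lia.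
Qed.

End TableauCriterion.

(** * Gale intervals *)

Section GaleExchange.
Variable n : nat.
Implicit Types (A B R S U : {set 'I_n}) (M : {set {set 'I_n}}) (d : 'I_n -> nat).

Definition seg A (j l : nat) : nat := #|[set i in A | j <= i < l]|.

Lemma cnt_seg A j l : j <= l -> cnt A l = cnt A j + seg A j l.
Proof.
move=> jl; rewrite /cnt -(cardsID [set i : 'I_n | i < j]); congr (_ + _).
  by apply: eq_card => i; rewrite !inE; case: (i \in A) => //=; lia.
by apply: eq_card => i; rewrite !inE; case: (i \in A) => //=; lia.
Qed.

Lemma seg_le A j l : seg A j l <= l - j.
Proof.
elim: l => [|l IHl]; first by rewrite leqn0 cards_eq0; apply/eqP/setP => i;
  rewrite !inE ltn0 !andbF.
have [lj|jl] := ltnP l j.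
  rewrite /seg (_ : [set i in A | _] = set0) ?cards0 //.
  by apply/setP => i; rewrite !inE; lia.
apply: (@leq_trans (seg A j l).+1); last by lia.
rewrite /seg; have [ln|nl] := ltnP l n.
  apply: leq_trans (subset_leq_card (_ : _ \subset
    Ordinal ln |: [set i in A | j <= i < l])) _.
    apply/subsetP => i; rewrite !inE => /and3P[-> -> /=]; rewrite -val_eqE /=; lia.
  by rewrite cardsU1; case: (_ \in _); rewrite /= ?add0n ?add1n.
apply: leq_trans (leqnSn _); apply: subset_leq_card; apply/subsetP => i.
by rewrite !inE => /and3P[-> -> _] /=; rewrite (leq_trans (ltn_ord i)).
Qed.

Lemma seg_sub A B j l : (forall i : 'I_n, j <= i < l -> i \in A -> i \in B) ->
  seg A j l <= seg B j l.
Proof.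
move=> AB; apply: subset_leq_card; apply/subsetP => i.
by rewrite !inE => /andP[iA il]; rewrite il (AB i).
Qed.

Lemma cnt_leq A j l : j <= l -> cnt A j <= cnt A l.
Proof. by move=> /cnt_seg ->; rewrite leq_addr. Qed.

Lemma cnt_agree A B j : #|A| = #|B| ->
  (forall i : 'I_n, j <= i -> (i \in A) = (i \in B)) -> cnt A j = cnt B j.
Proof.
move=> AB agree; have [nj|/ltnW jn] := leqP n j; first by rewrite !cnt_full.
have eqs : seg A j n = seg B j n.
  apply: eq_card => i; rewrite !inE; case: (leqP j i) => [/agree -> //|_].
  by rewrite !andbF.
by have := cnt_seg A jn; have := cnt_seg B jn; rewrite !(cnt_full _ (leqnn n)); lia.
Qed.

Lemma cnt_setT j : j <= n -> cnt [set: 'I_n] j = j.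
Proof.
move=> jn; rewrite /cnt -[RHS]card_ord -sum1_card -[RHS]sum1_card.
by rewrite (big_ord_widen n (fun=> 1) jn); apply: eq_bigl => i; rewrite !inE.
Qed.

(* Starting from A <= R <= B in M, modify A and B step by step so that they
   agree with R on ever longer final segments; the two closure conditions allow
   each exchange to be made with the nearest possible element. *)
Lemma gale_convex M k A B R :
  (forall X, X \in M -> #|X| = k) ->
  (forall X Y e, X \in M -> Y \in M -> e \in Y :\: X ->
     exists2 x, x \in X :\: Y & e |: (X :\ x) \in M) ->
  (forall X Y e, X \in M -> Y \in M -> e \in Y :\: X ->
     exists2 x, x \in X :\: Y & x |: (Y :\ e) \in M) ->
  (forall U (a b c : 'I_n), a \notin U -> b \notin U -> c \notin U -> a < b < c ->
     a |: U \in M -> c |: U \in M -> b |: U \in M) ->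
  (forall U (a b c : 'I_n), a \notin U -> b \notin U -> c \notin U -> a < b < c ->
     a |: (b |: U) \in M -> b |: (c |: U) \in M -> a |: (c |: U) \in M) ->
  A \in M -> B \in M -> #|R| = k ->
  (forall j, cnt B j <= cnt R j <= cnt A j) -> R \in M.
Proof.
move=> cardM ex1 ex2 cl1 cl2 AM BM Rk BRA.
pose agree m (X : {set 'I_n}) := forall i : 'I_n, m <= i -> (i \in X) = (i \in R).
pose P m := exists X Y, [/\ X \in M, Y \in M, agree m X, agree m Y &
  forall j, cnt Y j <= cnt R j <= cnt X j].
suff /(_ 0 isT) [X [_ [XM _ XR _ _]]] : forall m, m <= n -> P m.
  by rewrite (_ : R = X) //; apply/setP => i; rewrite XR.
suff step m (mn : m < n) : P m.+1 -> P m.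
  move=> m mn; rewrite -(subKn mn); elim: (n - m) (leq_subr m n) => [|t IHt] tn.
    by exists A, B; split=> // i; rewrite subn0 leqNgt ltn_ord.
  by apply: step; [lia | rewrite -subSn // subSS; apply: IHt; lia].
pose e := Ordinal mn.
have agreeS X : agree m.+1 X -> (e \in X) = (e \in R) -> agree m X.
  move=> Xa eX i; rewrite leq_eqVlt => /orP[/eqP mi|/Xa //].
  by rewrite (_ : i = e) //; apply: val_inj.
move=> [X [Y [XM YM Xa Ya YRX]]].
have cX : cnt X m.+1 = cnt R m.+1 by apply: cnt_agree => //; rewrite Rk cardM.
have cY : cnt Y m.+1 = cnt R m.+1 by apply: cnt_agree => //; rewrite Rk cardM.
have := cX; have := cY; rewrite !(cntS _ e) => cYe cXe.
have YRXe := YRX m.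
have [eR|eR] := boolP (e \in R).
  have eY : e \in Y by rewrite eR in cYe; case: (e \in Y) cYe => //=; lia.
  have Ya' : agree m Y by apply: agreeS => //; rewrite eY eR.
  have [eX|eX] := boolP (e \in X).
    by exists X, Y; split=> //; apply: agreeS => //; rewrite eX eR.
  have [|x /setDP[xX xY] xM] := ex1 X Y e XM YM; first by rewrite inE eX.
  have xm : x < m.
    rewrite ltnNge leq_eqVlt; apply/negP => /orP[/eqP mx|mx].
      by move: eX; rewrite (_ : e = x) ?xX //; apply: val_inj.
    by move: xX xY; rewrite Xa // Ya // => ->.
  have x0P : (x \in X) && (x < m) by rewrite xX.
  have [y /andP[yX ym] ymax] := @arg_maxnP _ x
    (fun y => (y \in X) && (y < m)) (fun y : 'I_n => y : nat) x0P.
  have eyX : e |: (X :\ y) \in M.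
    have [<- //|xy] := eqVneq x y.
    have ltxy : x < y.
      by have : x <= y := ymax x x0P; rewrite leq_eqVlt val_eqE (negPf xy).
    have eqU1 : y |: (X :\ x :\ y) = X :\ x.
      by rewrite setD1K // !inE eq_sym xy.
    have eqU2 : x |: (X :\ x :\ y) = X :\ y.
      by rewrite setDDl [[set x] :|: [set y]]setUC -setDDl setD1K // !inE xy.
    rewrite -eqU2 setUCA; apply: (cl2 _ x y e).
    - by rewrite !inE eqxx andbF.
    - by rewrite !inE eqxx.
    - by rewrite !inE (negPf eX) !andbF.
    - by rewrite ltxy.
    - by rewrite eqU1 setD1K.
    - by rewrite setUCA eqU1.
  exists (e |: (X :\ y)), Y; split=> //.
    move=> i; rewrite leq_eqVlt => /orP[/eqP mi|mi].
      by rewrite (_ : i = e) ?setU11 //; apply: val_inj.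
    rewrite !inE -!val_eqE /= gtn_eqF // (_ : (i == y :> nat) = false) ?Xa //.
    by apply: gtn_eqF; apply: leq_trans mi; rewrite ltnS ltnW.
  (* The choice of the largest [y] matters here: [X] has nothing between [y] and [m], so for
     [y < j <= m] its count at [j] equals its count at [m], which is one more than that of [R]. *)
  move=> j; have /andP[-> /= RX] := YRX j.
  rewrite cntU1 ?inE ?(negPf eX) ?andbF //=.
  have := cntD1 j yX; have [jm|mj] := leqP j m; last by clear -mj ym RX; lia.
  have [jy|yj] := leqP j y; first by clear -RX; lia.
  have g0 : seg X j m = 0.
    apply/eqP; rewrite cards_eq0; apply/eqP/setP => i; rewrite !inE.
    apply/negP => /and3P[iX ji im]; have : i <= y by apply: ymax; rewrite iX.
    by rewrite leqNgt (leq_trans yj ji).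
  have := cnt_seg X jm; rewrite g0; have := cnt_leq R jm.
  by move: cXe; rewrite eR (negPf eX) /=; clear -YRXe; lia.
have eX : e \notin X by rewrite (negPf eR) in cXe; case: (e \in X) cXe => //=; lia.
have Xa' : agree m X by apply: agreeS => //; rewrite (negPf eX) (negPf eR).
have [eY|eY] := boolP (e \in Y); last first.
  by exists X, Y; split=> //; apply: agreeS => //; rewrite (negPf eY) (negPf eR).
have [|x /setDP[xX xY] xM] := ex2 X Y e XM YM; first by rewrite inE eX.
have xm : x < m.
  rewrite ltnNge leq_eqVlt; apply/negP => /orP[/eqP mx|mx].
    by move: eX; rewrite (_ : e = x) ?xX //; apply: val_inj.
  by move: xX xY; rewrite Xa // Ya // => ->.
have x0P : (x \notin Y) && (x < m) by rewrite xY.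
have [z /andP[zY zm] zmax] := @arg_maxnP _ x
  (fun y => (y \notin Y) && (y < m)) (fun y : 'I_n => y : nat) x0P.
have zeY : z |: (Y :\ e) \in M.
  have [<- //|xz] := eqVneq x z.
  have ltxz : x < z.
    by have : x <= z := zmax x x0P; rewrite leq_eqVlt val_eqE (negPf xz).
  apply: (cl1 _ x z e) => //; rewrite ?inE ?(negPf xY) ?(negPf zY) ?eqxx ?andbF //.
    by rewrite ltxz.
  by rewrite setD1K.
exists X, (z |: (Y :\ e)); split=> //.
  move=> i; rewrite leq_eqVlt => /orP[/eqP mi|mi].
    rewrite (_ : i = e) ?(negPf eR) ?inE ?eqxx ?orbF; last exact: val_inj.
    by rewrite -val_eqE /= gtn_eqF.
  rewrite !inE -!val_eqE /= (gtn_eqF mi) /= (_ : (i == z :> nat) = false) ?Ya //.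
  by apply: gtn_eqF; apply: leq_trans mi; rewrite ltnS ltnW.
move=> j; have /andP[YR ->] := YRX j; rewrite andbT.
rewrite cntU1 ?inE ?(negPf zY) ?andbF //=.
have := cntD1 j eY; rewrite (_ : (e : nat) = m) //; move: (cnt (Y :\ e) j) => c.
have [jm|mj] := leqP j m; last by clear -mj zm YR; lia.
have [jz|zj] := leqP j z; first by clear -YR; lia.
(* Dually, [Y] contains everything between [z] and [m], so no set grows faster than [Y] on that
   range, and at [m] the set [R] is ahead of [Y] by one. *)
have g1 : m - j <= seg Y j m.
  have -> : m - j = seg setT j m; last first.
    apply: seg_sub => i /andP[ji im] _; apply: contraLR (zj) => iY.
    rewrite -leqNgt (leq_trans ji) //; apply: zmax; by rewrite iY.
  have := cnt_seg setT jm; rewrite !cnt_setT ?(leq_trans jm) ?(ltnW mn) //.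
  by clear; lia.
have := cnt_seg Y jm; have := cnt_seg R jm; have := seg_le R j m.
by move: cYe; rewrite eY (negPf eR) /=; clear -YRXe g1 jm; lia.
Qed.

End GaleExchange.

(** * Quotient exchange between Gale intervals and weight-optimal flags *)

Section GaleFlags.
Variable n : nat.
Implicit Types (A B R S U G : {set 'I_n}) (M : {set {set 'I_n}}) (d : 'I_n -> nat).

Definition gale_between A B R := forall j, cnt B j <= cnt R j <= cnt A j.

(* Scan from x to the left and to the right until one of the four inequalities
   in gale_between A B R and gale_between A' B' R' becomes an equality that
   forbids the exchange; an element of R' :\: R met before that can be
   exchanged with x. *)
Lemma gale_quotient_exchange A B A' B' R R' x :
  #|R| = #|B| -> A \subset A' -> B \subset B' ->
  #|A'| <= #|A|.+1 -> #|B'| <= #|B|.+1 ->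
  gale_between A B R -> gale_between A' B' R' ->
  (exists2 Q : {set 'I_n}, Q \subset R' & gale_between A B Q) ->
  (exists2 Q : {set 'I_n}, R \subset Q & gale_between A' B' Q) ->
  x \in R :\: R' ->
  exists y, [/\ y \in R' :\: R, gale_between A B (y |: (R :\ x)) &
                gale_between A' B' (x |: (R' :\ y))].
Proof.
move=> RB AA' BB' cA cB bR bR' [Q QR' bQ] [Q' RQ' bQ'] /setDP[xR xR'].
pose right j := (x < j) && ((cnt R j == cnt B j) || (cnt R' j == cnt A' j)).
pose left j := (j <= x) && ((cnt R j == cnt A j) || (cnt R' j == cnt B' j)).
have ex_right : exists j, right j.
  by exists n; rewrite /right ltn_ord !(cnt_full _ (leqnn n)) RB eqxx.
have ex_left : exists j, left j by exists 0; rewrite /left !cnt0 eqxx.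
have left_max j : left j -> j <= x by case/andP.
have [j1 /andP[xj1 right1] min1] := ex_minnP ex_right.
have [j0 /andP[j0x left0] max0] := ex_maxnP ex_left left_max.
have [/existsP[y /and3P[yR' yR /andP[j0y yj1]]]|] :=
    boolP [exists y, [&& y \in R', y \notin R & j0 <= y < j1]].
  have neq_xy : x != y by apply: contraNneq yR => <-.
  exists y; split; first by rewrite inE yR.
    move=> j; rewrite cntU1 ?inE ?(negPf yR) ?andbF //.
    have := cntD1 j xR; have := bR j; move: neq_xy; rewrite -val_eqE /=.
    have := min1 j; have := max0 j; rewrite /left /right.
    by clear -j0y yj1; lia.
  move=> j; rewrite cntU1 ?inE ?(negPf xR') ?andbF //.
  have := cntD1 j yR'; have := bR' j; move: neq_xy; rewrite -val_eqE /=.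
  have := min1 j; have := max0 j; rewrite /left /right.
  by clear -j0y yj1; lia.
rewrite negb_exists => /forallP noy; exfalso.
have j01 : j0 <= j1 by apply: leq_trans j0x (ltnW xj1).
have ltseg : seg R' j0 j1 < seg R j0 j1.
  apply: proper_card; apply/properP; split.
    apply/subsetP => y; rewrite !inE => /andP[yR' jy]; rewrite jy andbT.
    by have := noy y; rewrite yR' jy !andbT negbK.
  by exists x; rewrite !inE ?(negPf xR') // xR j0x.
(* Now [R] has more elements than [R'] in the window from [j0] to [j1]. Each of the four
   combinations of end equalities contradicts this through one inclusion: [Q] in [R'] if both
   equalities concern [R], [R] in [Q'] if both concern [R'], and [A] in [A'] or [B] in [B'] in the
   mixed cases. *)
have sAA' := seg_sub (fun i (_ : j0 <= i < j1) => subsetP AA' i).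
have sBB' := seg_sub (fun i (_ : j0 <= i < j1) => subsetP BB' i).
have sQR' := seg_sub (fun i (_ : j0 <= i < j1) => subsetP QR' i).
have sRQ' := seg_sub (fun i (_ : j0 <= i < j1) => subsetP RQ' i).
have cle (C C' : {set 'I_n}) j : C \subset C' -> #|C'| <= #|C|.+1 ->
  cnt C j <= cnt C' j <= (cnt C j).+1.
  move=> CC' cC; apply/andP; split.
    apply: subset_leq_card; apply/subsetP => i; rewrite !inE => /andP[iC ->].
    by rewrite (subsetP CC').
  have [nj|/ltnW jn] := leqP n j; first by rewrite !cnt_full.
  have := cnt_seg C jn; have := cnt_seg C' jn; rewrite !(cnt_full _ (leqnn n)).
  by have := seg_sub (fun i (_ : j <= i < n) => subsetP CC' i); clear -cC; lia.
have := cle _ _ j0 AA' cA; have := cle _ _ j1 AA' cA.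
have := cle _ _ j0 BB' cB; have := cle _ _ j1 BB' cB.
have := cnt_seg R j01; have := cnt_seg R' j01; have := cnt_seg Q j01.
have := cnt_seg Q' j01; have := cnt_seg A j01; have := cnt_seg A' j01.
have := cnt_seg B j01; have := cnt_seg B' j01.
have := bR j0; have := bR j1; have := bR' j0; have := bR' j1.
have := bQ j0; have := bQ j1; have := bQ' j0; have := bQ' j1.
by clear -left0 right1 ltseg sAA' sBB' sQR' sRQ'; lia.
Qed.

Definition initial d S := forall i j, i \in S -> j \notin S -> d i < d j.

(** If [G] had more of [S] than [R], exchange some [x] of [S :&: G] missing from [R] for a [y] of
    [R]. Maximality of [G] gives [d y <= d x], so [y] is in [S] too; [R] keeps its number of
    elements of [S] and comes closer to [G]. *)
Lemma max_weight_initial d M G R S :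
  (forall X Y x, X \in M -> Y \in M -> x \in X :\: Y ->
     exists y, [/\ y \in Y :\: X, y |: (X :\ x) \in M & x |: (Y :\ y) \in M]) ->
  G \in M -> (forall X, X \in M -> \sum_(i in X) d i <= \sum_(i in G) d i) ->
  initial d S -> R \in M -> #|S :&: G| <= #|S :&: R|.
Proof.
move=> exM GM maxG Sd; have [m] := ubnP #|G :\: R|; elim: m R => // m IHm R Rm RM.
rewrite leqNgt; apply/negP => lt.
have [x] : exists x, x \in (S :&: G) :\: R.
  apply/set0Pn; apply: contraTneq lt => /eqP; rewrite setD_eq0 => sub.
  by rewrite -leqNgt; apply: subset_leq_card; rewrite subsetI subsetIl.
rewrite !inE => /and3P[xR xS xG].
have [|y [/setDP[yR yG] GM' RM']] := exM G R x GM RM; first by rewrite inE xR.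
have yS : y \in S.
  apply/negPn/negP => yS; have := maxG _ GM'.
  rewrite (big_setD1 x xG) big_setU1 ?inE ?(negPf yG) ?andbF //= leq_add2r.
  by rewrite leqNgt Sd.
have := (fun lt' => IHm (x |: (R :\ y)) lt' RM').
have -> : S :&: (x |: (R :\ y)) = x |: ((S :&: R) :\ y).
  by apply/setP => i; rewrite !inE; case: (eqVneq i x) => [->|] //=;
    rewrite ?xS // andbCA.
rewrite cardsU1 !inE (negPf xR) !andbF /=.
have -> : G :\: (x |: R :\ y) = (G :\: R) :\ x.
  apply/setP => i; rewrite !inE; case: (eqVneq i y) => [->|_] /=.
    by rewrite (negPf yG) !andbF.
  by rewrite negb_or andbA.
have := cardsD1 x (G :\: R); rewrite !inE xR xG /=.
have := cardsD1 y (S :&: R); rewrite !inE yS yR /=.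
clear -lt Rm; move: lt Rm => /= lt Rm e1 e2 IH; have /= := IH; lia.
Qed.

Lemma flag_perm (G : nat -> {set 'I_n}) :
  (forall k, k <= n -> #|G k| = k) -> (forall k, k < n -> G k \subset G k.+1) ->
  exists w : 'S_n, forall k, k <= n -> proj k w = G k.
Proof.
move=> cG sG.
have mono k l : k <= l <= n -> G k \subset G l.
  move=> /andP[kl]; elim: l kl => [|l IHl]; first by rewrite leqn0 => /eqP ->.
  rewrite leq_eqVlt => /orP[/eqP -> //|kl ln].
  by apply: subset_trans (sG _ ln); apply: IHl => //; apply: ltnW.
have fP (p : 'I_n) : {i | i \in G p.+1 :\: G p}.
  apply/sigW; apply/set0Pn; rewrite -card_gt0 cardsD.
  have := subset_leq_card (subsetIr (G p.+1) (G p)).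
  rewrite (cG _ (ltn_ord p)) (cG _ (ltnW (ltn_ord p))) => le.
  by rewrite subn_gt0 ltnS.
pose f p := sval (fP p).
have fG p : (f p \in G p.+1) /\ (f p \notin G p) by have /setDP := svalP (fP p).
have f_lt (p q : 'I_n) : p < q -> f p != f q.
  move=> pq; apply: contraNneq (fG q).2 => <-.
  by apply: (subsetP (mono p.+1 q _)) (fG p).1; rewrite pq ltnW.
have fI : injective f.
  move=> p q fpq; have [pq|qp|/val_inj //] := ltngtP p q.
    by have := f_lt _ _ pq; rewrite fpq eqxx.
  by have := f_lt _ _ qp; rewrite fpq eqxx.
exists (perm fI) => k kn; apply/eqP.
rewrite eqEcard cG // card_proj // leqnn andbT; apply/subsetP => i.
rewrite mem_proj => ik; have := (fG ((perm fI)^-1 i)%g).1.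
rewrite -(permE fI) permKV; apply: subsetP; apply: mono.
by rewrite ik.
Qed.

(** This is the Gelfand-Serganova maximality property of flag matroids, for [I] read as a set of
    complete flags; [d] encodes the linear order, and the single [w] serves all levels. *)
Definition greedy (I : {set 'S_n}) : Prop :=
  forall d, injective d -> exists2 w, w \in I &
    forall S k w', initial d S -> k <= n -> w' \in I ->
      #|S :&: proj k w| <= #|S :&: proj k w'|.

Lemma sub_proj (w : 'S_n) k l : k <= l -> proj k w \subset proj l w.
Proof.
by move=> kl; apply/subsetP => i; rewrite !mem_proj => /leq_trans; apply.
Qed.

Lemma gale_greedy (u v : 'S_n) : bruhat_le u v ->
  (forall k, 1 <= k <= n ->
     proj k @: bruhat_interval u v = gale_interval k (proj k u) (proj k v)) ->
  greedy (bruhat_interval u v).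
Proof.
move=> uv galeI d dI; pose M k := gale_interval k (proj k u) (proj k v).
have MP k R : k <= n ->
    R \in M k <-> #|R| = k /\ gale_between (proj k u) (proj k v) R.
  by move=> kn; apply: mem_gale_interval; rewrite card_proj.
have proj0 (w : 'S_n) : proj 0 w = set0 by apply/setP => i; rewrite mem_proj inE.
have M_proj k R : k <= n -> R \in M k ->
  exists2 w, w \in bruhat_interval u v & R = proj k w.
  case: k => [|k] kn; last by rewrite /M -galeI //; move/imsetP.
  move=> /(MP 0) []// /cards0_eq -> _; exists u; rewrite ?proj0 //.
  by rewrite inE uv andbT; apply: connect0.
have proj_M k w : k <= n -> w \in bruhat_interval u v -> proj k w \in M k.
  move=> kn; rewrite inE => /andP[/bruhat_leP uw /bruhat_leP wv].
  by apply/MP => //; rewrite card_proj //; split=> // j; rewrite uw wv.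
(* The case [l = k] is exchange within one level and yields optimality on initial sets; the case
   [l = k.+1] makes the optimal sets nested. The auxiliary sets [Q] and [Q'] are projections of
   permutations that realize [R'] and [R]. *)
have exM k l R R' x : k <= l -> l <= k.+1 -> l <= n -> R \in M k -> R' \in M l ->
    x \in R :\: R' ->
    exists y, [/\ y \in R' :\: R, y |: (R :\ x) \in M k & x |: (R' :\ y) \in M l].
  move=> kl lk ln RM R'M xR; have kn := leq_trans kl ln.
  have /(MP _ _ kn) [cR bR] := RM; have /(MP _ _ ln) [cR' bR'] := R'M.
  have [] := @gale_quotient_exchange (proj k u) (proj k v) (proj l u) (proj l v) R R' x;
    rewrite ?card_proj ?sub_proj //.
  - have [w wI R'E] := M_proj _ _ ln R'M; exists (proj k w).
      by rewrite R'E sub_proj.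
    by have /(MP _ _ kn)[] := proj_M _ _ kn wI.
  - have [w wI RE] := M_proj _ _ kn RM; exists (proj l w).
      by rewrite RE sub_proj.
    by have /(MP _ _ ln)[] := proj_M _ _ ln wI.
  move=> y [yR b1 b2]; exists y; split=> //.
    apply/MP => //; split=> //; move: xR yR; rewrite !inE => /andP[_ xR] /andP[yR _].
    by rewrite cardsU1 !inE (negPf yR) andbF -cR (cardsD1 x R) xR.
  apply/MP => //; split=> //; move: xR yR; rewrite !inE => /andP[xR _] /andP[_ yR].
  by rewrite cardsU1 !inE (negPf xR) andbF -cR' (cardsD1 y R') yR.
pose weight (X : {set 'I_n}) := \sum_(i in X) d i.
pose G k := [arg max_(X > proj k u in M k) weight X].
have uI : u \in bruhat_interval u v by rewrite inE uv andbT; apply: connect0.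
have GP k : k <= n -> G k \in M k /\ forall X, X \in M k -> weight X <= weight (G k).
  by move=> kn; rewrite /G; case: arg_maxnP => //; apply: proj_M.
have [k kn|k kn|w wG] := @flag_perm G.
- by have /(MP _ _ kn)[] := (GP k kn).1.
- have kn' := ltnW kn; have [GM Gmax] := GP k kn'; have [GM' Gmax'] := GP k.+1 kn.
  apply/subsetP => x xG; apply/negPn/negP => xG'.
  have [||y [/setDP[yG' yG] M1 M2]] :=
    exM k k.+1 (G k) (G k.+1) x (leqnSn k) _ kn GM GM' _ => //.
    by rewrite inE xG'.
  (* Neither exchange may gain weight, so [d x = d y], and injectivity of [d] identifies [x] with
     [y]. *)
  have := Gmax _ M1; have := Gmax' _ M2; rewrite /weight.
  rewrite (big_setD1 y yG') (big_setD1 x xG) /= !big_setU1 ?inE ?(negPf yG) ?(negPf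
    xG') ?andbF //.
  rewrite !leq_add2r => xy yx.
  have /dI eq_xy : d x = d y by apply/eqP; rewrite eqn_leq xy yx.
  by rewrite -eq_xy xG in yG.
exists w; last first.
  move=> S k w' Sd kn w'I; rewrite wG //; have [GM Gmax] := GP k kn.
  apply: max_weight_initial Gmax Sd (proj_M _ _ kn w'I) => //.
  by move=> X Y x; apply: exM.
have bw k : k <= n -> gale_between (proj k u) (proj k v) (proj k w).
  by move=> kn; rewrite wG //; have /(MP _ _ kn)[] := (GP k kn).1.
have proj_n (x : 'S_n) k : n <= k -> proj k x = proj n x.
  move=> nk; apply/setP => i; rewrite !mem_proj ltn_ord.
  by rewrite (leq_trans (ltn_ord _) nk).
rewrite inE; apply/andP; split; apply/bruhat_leP => k j;
  have [kn|/ltnW nk] := leqP k n; rewrite ?(proj_n _ _ nk).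
- by case/andP: (bw k kn j).
- by case/andP: (bw n (leqnn n) j).
- by case/andP: (bw k kn j).
- by case/andP: (bw n (leqnn n) j).
Qed.

End GaleFlags.

(** * The three-term relation *)

Ltac clash := try by match goal with H : ?x <> ?x |- _ => case: (H erefl) end.

(** [da], [db], [dc] are the least and [ea], [eb], [ec] the greatest values of the three coordinates
    on the hexagon, whose vertices all permute X, Y, Z. The disequalities hold because a least and a
    greatest value of different coordinates occur at a common vertex, and the bounds place the
    remaining coordinate of that vertex between its extremes. What is left is a finite check. *)
Lemma hexagon_arith X Y Z da db dc ea eb ec : X < Y < Z ->
  (da = X \/ da = Y \/ da = Z) -> (db = X \/ db = Y \/ db = Z) ->
  (dc = X \/ dc = Y \/ dc = Z) -> (ea = X \/ ea = Y \/ ea = Z) ->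
  (eb = X \/ eb = Y \/ eb = Z) -> (ec = X \/ ec = Y \/ ec = Z) ->
  da <> eb -> da <> ec -> db <> ea -> db <> ec -> dc <> ea -> dc <> eb ->
  db + da + ec <= X + Y + Z <= eb + da + ec ->
  dc + da + eb <= X + Y + Z <= ec + da + eb ->
  da + db + ec <= X + Y + Z <= ea + db + ec ->
  dc + db + ea <= X + Y + Z <= ec + db + ea ->
  da + dc + eb <= X + Y + Z <= ea + dc + eb ->
  db + dc + ea <= X + Y + Z <= eb + dc + ea ->
  db + (X + Y + Z - eb) =
    minn (da + (X + Y + Z - ea)) (X + Y + Z - ec + dc) <->
  ~ (ea = ec /\ eb < ea) /\ ~ (da = dc /\ da < db).
Proof.
move=> XYZ [->|[->|->]] [->|[->|->]] h3 h4 h5 h6 n1 n2 n3 n4 n5 n6;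
  case: h4 n3 n5 => [->|[->|->]] n3 n5; clash;
  case: h5 n1 n6 => [->|[->|->]] n1 n6; clash;
  case: h6 n2 n4 => [->|[->|->]] n2 n4; clash;
  case: h3 n5 n6 => [->|[->|->]] n5 n6; clash; clear n1 n2 n3 n4 n5 n6.
all: lia.
Qed.

(** * Integer coordinates and weights of twisted points *)

Section Weights.
Variable n : nat.
Implicit Types (S X U : {set 'I_n}) (w : 'S_n) (i : 'I_n).

(* The i-th coordinate of the twisted point of w, as a natural number. *)
Definition xcoord w i : nat := n - (w^-1)%g i.
Definition wt X w : nat := \sum_(i in X) xcoord w i.

Lemma xcoord_inj w : injective (xcoord w).
Proof.
move=> i j; rewrite /xcoord => ij; apply: (@perm_inj _ w^-1%g); apply: val_inj => /=.
by move: ij (ltn_ord (w^-1%g i)) (ltn_ord (w^-1%g j)); clear; lia.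
Qed.

Lemma xcoord_le w i : 0 < xcoord w i <= n.
Proof. by rewrite /xcoord; have := ltn_ord (w^-1%g i); clear; lia. Qed.

Lemma proj_xcoord w k i : k <= n -> (i \in proj k w) = (n - k < xcoord w i).
Proof.
by rewrite mem_proj /xcoord => kn; have := ltn_ord (w^-1%g i); move: kn; clear; lia.
Qed.

Lemma wt_proj X w : wt X w = \sum_(1 <= k < n.+1) #|X :&: proj k w|.
Proof.
have sum_ge m p : \sum_(0 <= k < m) (p <= k) = m - p.
  elim: m => [|m IHm]; first by rewrite big_geq.
  by rewrite big_nat_recr //= IHm; clear; lia.
rewrite /wt (eq_bigr (fun i => \sum_(1 <= k < n.+1) (i \in proj k w))); last first.
  move=> i _; rewrite big_add1 /xcoord -sum_ge; apply: eq_bigr => k _.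
  by rewrite mem_proj ltnS.
rewrite exchange_big; apply: eq_bigr => k _.
rewrite -sum1_card big_mkcond [RHS]big_mkcond; apply: eq_bigr => i _.
by rewrite inE; case: (i \in X) => //=; case: (i \in proj k w).
Qed.

Lemma wtU1 X w i : i \notin X -> wt (i |: X) w = xcoord w i + wt X w.
Proof. by move=> iX; rewrite /wt big_setU1. Qed.

End Weights.

(** * Exchange properties of the projections of a greedy set *)

Section GreedySets.
Variables (n : nat) (I : {set 'S_n}).
Hypothesis gI : greedy I.
Implicit Types (S X U T Q : {set 'I_n}) (w : 'S_n) (d l : 'I_n -> nat).

(** Stronger than minimality of [wt X], which by [wt_proj] is the sum of these cardinalities over
    [k]. *)
Definition kmin X w := forall k w', k <= n -> w' \in I ->
  #|X :&: proj k w| <= #|X :&: proj k w'|.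

Lemma kmin_wt X w w' : kmin X w -> w' \in I -> wt X w <= wt X w'.
Proof.
move=> Xw w'I; rewrite !wt_proj !big_nat; apply: leq_sum => k /andP[_ kn].
exact: Xw.
Qed.

Lemma card_projC X k w : k <= n -> #|X :&: proj k w| + #|~: X :&: proj k w| = k.
Proof.
by move=> kn; rewrite ![_ :&: proj k w]setIC -setDE cardsID card_proj.
Qed.

(** Breaking the ties of [l] by the index gives an injective order whose initial sets include the
    complements of the upper level sets; at a fixed [k], few elements in the complement means many
    in the level set. *)
Lemma greedy_level l : exists2 w, w \in I & forall t k w', k <= n -> w' \in I ->
  #|[set i | t <= l i] :&: proj k w'| <= #|[set i | t <= l i] :&: proj k w|.
Proof.
have [|w wI min] := gI (d := fun i => l i * n + i).
  move=> i j eq_ij; apply: val_inj => /=.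
  have := congr1 (modn^~ n) eq_ij; rewrite !modnMDl !modn_small //.
exists w => // t k w' kn w'I.
have init : initial (fun i => l i * n + i) (~: [set i | t <= l i]).
  move=> i j; rewrite !inE negbK -ltnNge => lit tlj.
  apply: (@leq_trans (l i * n + n)); first by rewrite ltn_add2l.
  by rewrite -mulSnr (leq_trans _ (leq_addr _ _)) // leq_mul2r (leq_trans lit tlj) orbT.
rewrite -(leq_add2r #|~: [set i | t <= l i] :&: proj k w|) card_projC //.
by rewrite -[leqRHS](card_projC [set i | t <= l i] w' kn) leq_add2l min.
Qed.

Lemma greedy_proj_sub w w' k X : #|X :&: proj k w'| <= #|X :&: proj k w| ->
  X \subset proj k w' -> X \subset proj k w.
Proof.
move=> le Xw'; apply/setIidPl/eqP; rewrite eqEcard subsetIl.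
by apply: leq_trans le; rewrite (setIidPl Xw').
Qed.

Lemma greedy_proj_sup w w' k X : k <= n ->
  #|X :&: proj k w'| <= #|X :&: proj k w| ->
  proj k w' \subset X -> proj k w \subset X.
Proof.
move=> kn le w'X; apply/setIidPr/eqP; rewrite eqEcard subsetIr.
by rewrite (leq_trans _ le) // (setIidPr w'X) !card_proj.
Qed.

Lemma card_subU1 X (G : {set 'I_n}) : X \subset G -> #|G| = #|X|.+1 ->
  exists2 y, y \in G :\: X & G = y |: X.
Proof.
move=> XG cG; have /eqP/cards1P[y yE] : #|G :\: X| = 1.
  by rewrite cardsD (setIidPr XG) cG subSnn.
exists y; first by rewrite yE inE.
by rewrite -yE setUC setDE setUIr setUCr setIT (setUidPr XG).
Qed.

(** Prefer [A :&: B], then [e], then the rest of [A]. Comparison with [wX] forces the optimal set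
    into [e |: A], comparison with [wY] forces it to contain [e |: (A :&: B)]; so it is [e |: A]
    without one element outside [B]. *)
Lemma proj_exchange_in k X (Y : {set 'I_n}) e : k <= n ->
  X \in proj k @: I -> Y \in proj k @: I -> e \in Y :\: X ->
  exists2 x, x \in X :\: Y & e |: (X :\ x) \in proj k @: I.
Proof.
move=> kn /imsetP[wX wXI ->] /imsetP[wY wYI ->]; set A := proj k wX; set B := proj k wY.
move=> /setDP[eB eA].
have [w wI wmax] := greedy_level (fun i =>
  if i \in A :&: B then 3 else if i == e then 2 else if i \in A then 1 else 0).
have level1 : [set i | 1 <= if i \in A :&: B then 3 else
    if i == e then 2 else if i \in A then 1 else 0] = e |: A.
  by apply/setP => i; rewrite !inE; case: (i == e); case: (i \in A); case: (i \in B).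
have level2 : [set i | 2 <= if i \in A :&: B then 3 else
    if i == e then 2 else if i \in A then 1 else 0] = e |: (A :&: B).
  by apply/setP => i; rewrite !inE; case: (i == e); case: (i \in A); case: (i \in B).
have sub1 : proj k w \subset e |: A.
  by rewrite -level1; apply: greedy_proj_sup (wmax 1 k wX kn wXI) _;
    rewrite // level1 subsetU1.
have sub2 : e |: (A :&: B) \subset proj k w.
  rewrite -level2; apply: greedy_proj_sub (wmax 2 k wY kn wYI) _.
  by rewrite level2 subUset sub1set eB subsetIr.
have [|x /setDP[xeA xw] eAE] := card_subU1 sub1.
  by rewrite cardsU1 eA !card_proj.
have ex : x != e.
  by apply: contraNneq xw => ->; apply: (subsetP sub2); rewrite setU11.
have xA : x \in A by move: xeA; rewrite !inE (negPf ex).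
exists x.
  rewrite inE xA andbT; apply: contraNN xw => xB; apply: (subsetP sub2).
  by rewrite !inE xA xB orbT.
rewrite (_ : e |: A :\ x = proj k w) ?imset_f //.
have <- : (e |: A) :\ x = proj k w by rewrite eAE setU1K.
by apply/setP => i; rewrite !inE; case: (eqVneq i e) => [->|//]; rewrite eq_sym ex.
Qed.

(** Prefer [B :\ e], then [A]. The optimal set contains [B :\ e] and lies in [A :|: (B :\ e)], so
    its one further element comes from [A], and it is not [e] because [e] is outside [A]. *)
Lemma proj_exchange_out k X (Y : {set 'I_n}) e : k <= n ->
  X \in proj k @: I -> Y \in proj k @: I -> e \in Y :\: X ->
  exists2 x, x \in X :\: Y & x |: (Y :\ e) \in proj k @: I.
Proof.
move=> kn /imsetP[wX wXI ->] /imsetP[wY wYI ->]; set A := proj k wX; set B := proj k wY.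
move=> /setDP[eB eA].
have [w wI wmax] := greedy_level (fun i =>
  if i \in B :\ e then 2 else if i \in A then 1 else 0).
have level1 : [set i | 1 <= if i \in B :\ e then 2 else if i \in A then 1 else 0]
    = A :|: (B :\ e).
  by apply/setP => i; rewrite !inE; case: (i == e); case: (i \in A); case: (i \in B).
have level2 : [set i | 2 <= if i \in B :\ e then 2 else if i \in A then 1 else 0]
    = B :\ e.
  by apply/setP => i; rewrite !inE; case: (i == e); case: (i \in A); case: (i \in B).
have sub1 : proj k w \subset A :|: (B :\ e).
  by rewrite -level1; apply: greedy_proj_sup (wmax 1 k wX kn wXI) _;
    rewrite // level1 subsetUl.
have sub2 : B :\ e \subset proj k w.
  rewrite -level2; apply: greedy_proj_sub (wmax 2 k wY kn wYI) _.
  by rewrite level2 subsetDl.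
have [|y /setDP[yw yB] wE] := card_subU1 sub2.
  by rewrite card_proj // -[LHS](card_proj wY kn) (cardsD1 e) eB.
have yA : y \in A by have := subsetP sub1 _ yw; rewrite inE (negPf yB) orbF.
exists y; last by rewrite -wE imset_f.
rewrite inE yA andbT; apply: contraNN yB => yB; rewrite !inE yB andbT.
by apply: contraNneq eA => <-.
Qed.

End GreedySets.

(** * The six vertices attached to [S] and three further values *)

Section Hexagon.
Variables (n : nat) (I : {set 'S_n}) (w0 : 'S_n).
Hypotheses (gI : greedy I) (w0I : w0 \in I).
Implicit Types (S X U T Q : {set 'I_n}) (w : 'S_n) (e f g i j : 'I_n).

Definition minwt X : nat := wt X [arg min_(w < w0 in I) wt X w].

Lemma minwt_le X w : w \in I -> minwt X <= wt X w.
Proof. by rewrite /minwt; case: arg_minnP => // w1 _; apply. Qed.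

Lemma kminE X w : w \in I -> kmin I X w -> wt X w = minwt X.
Proof.
move=> wI Xw; apply/eqP; rewrite eqn_leq minwt_le // andbT.
by rewrite /minwt; case: arg_minnP => // w1 w1I _; apply: kmin_wt Xw w1I.
Qed.

(** The predecessors of [i] in the order that lists [S], then the three elements of [Q] outside [S],
    then the rest, ordered by index within [S] and within the rest. The arrangement of the three
    does not enter, so all six vertices have the same coordinates elsewhere. *)
Definition before S Q i :=
  if i \in S then [set j in S | j < i] else Q :|: [set j : 'I_n | j < i].

Lemma hexagon_perm S Q e f g : uniq [:: e; f; g] ->
  e \notin S -> f \notin S -> g \notin S -> Q = g |: (f |: (e |: S)) ->
  exists w, [/\ w \in I, kmin I S w /\ kmin I (e |: S) w, kmin I (f |: (e |: S)) w,
    kmin I Q w & forall i, i \notin [:: e; f; g] ->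
      xcoord w i = minwt (i |: before S Q i) - minwt (before S Q i)].
Proof.
rewrite /= !inE !negb_or andbT => /andP[/andP[ef eg] fg] eS fS gS QE.
pose l i := if i \in S then 0 else if i == e then 1 else if i == f then 2
  else if i == g then 3 else 4.
pose d i := l i * n + i.
have dI : injective d.
  move=> i j eq_ij; apply: val_inj => /=.
  by have := congr1 (modn^~ n) eq_ij; rewrite /d !modnMDl !modn_small.
have d_lt i j : (d i < d j) = (l i < l j) || (l i == l j) && (i < j).
  rewrite /d; have [lij|lji|->] := ltngtP (l i) (l j); last by rewrite ltn_add2l.
    apply: (@leq_trans (l i * n + n)); first by rewrite ltn_add2l.
    by rewrite -mulSnr (leq_trans _ (leq_addr _ _)) // leq_mul2r lij orbT.
  apply/negbTE; rewrite -leqNgt; apply: ltnW; apply: (@leq_trans (l j * n + n)).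
    by rewrite ltn_add2l.
  by rewrite -mulSnr (leq_trans _ (leq_addr _ _)) // leq_mul2r lji orbT.
have [w wI wmin] := gI dI.
have level t : kmin I [set i | l i < t] w.
  move=> k w' kn w'I; apply: wmin => // i j; rewrite !inE -leqNgt d_lt => it tj.
  by rewrite (leq_trans it tj).
have prefix t : kmin I [set j | d j < t] w.
  move=> k w' kn w'I; apply: wmin => // i j; rewrite !inE -leqNgt => it tj.
  by rewrite (leq_trans it tj).
have l1 : [set i | l i < 1] = S.
  apply/setP => i; rewrite !inE /l.
  by case: (i \in S) => //; do 3!(case: (_ == _) => //).
have l2 : [set i | l i < 2] = e |: S.
  apply/setP => i; rewrite !inE /l; case: (eqVneq i e) => [->|_].
    by rewrite (negPf eS).
  by case: (i \in S) => //; do 2!(case: (_ == _) => //).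
have l3 : [set i | l i < 3] = f |: (e |: S).
  apply/setP => i; rewrite !inE /l; case: (eqVneq i f) => [->|_].
    by rewrite (negPf fS); case: (_ == _).
  by case: (i \in S) => //; do 2!(case: (_ == _) => //).
have l4 : [set i | l i < 4] = Q.
  apply/setP => i; rewrite QE !inE /l; case: (eqVneq i g) => [->|_].
    by rewrite (negPf gS); do 2!case: (_ == _).
  by case: (i \in S) => //; do 2!(case: (_ == _) => //).
exists w; split=> //.
- by split; [rewrite -l1 | rewrite -l2]; apply: level.
- by rewrite -l3; apply: level.
- by rewrite -l4; apply: level.
move=> i; rewrite !inE !negb_or => /and3P[ie if_ ig].
have beforeE : before S Q i = [set j | d j < d i].
  apply/setP => j; rewrite /before inE d_lt.
  have [iS|iS] := boolP (i \in S).
    have -> : l i = 0 by rewrite /l iS.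
    by rewrite inE ltn0 /= -[in LHS]l1 inE ltnS leqn0.
  have -> : l i = 4 by rewrite /l (negPf iS) (negPf ie) (negPf if_) (negPf ig).
  rewrite !inE -l4 inE.
  have : l j < 5 by rewrite /l; case: (j \in S) => //; do 3!(case: (_ == _) => //).
  by move: (l j) => lj; case: (ltngtP lj 4) => //= h; rewrite ltnNge h.
have uE : i |: before S Q i = [set j | d j < (d i).+1].
  apply/setP => j; rewrite beforeE !inE ltnS [in RHS]leq_eqVlt.
  by rewrite (inj_eq dI).
have k1 : kmin I (before S Q i) w by rewrite beforeE; apply: prefix.
have k2 : kmin I (i |: before S Q i) w by rewrite uE; apply: prefix.
by rewrite -(kminE wI k1) -(kminE wI k2) wtU1 ?addnK // beforeE inE ltnn.
Qed.

Lemma xcoord_same_values w w' (T : seq 'I_n) e :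
  (forall i, i \notin T -> xcoord w i = xcoord w' i) -> e \in T ->
  exists2 i, i \in T & xcoord w e = xcoord w' i.
Proof.
move=> out eT; pose i := w' (w^-1%g e).
have ei : xcoord w e = xcoord w' i by rewrite /xcoord /i permK.
exists i => //; apply/negPn/negP => iT.
have := out i iT; rewrite -ei => /xcoord_inj ie.
by rewrite ie eT in iT.
Qed.

Lemma sort3 (p q r : nat) : p <> q -> p <> r -> q <> r ->
  exists x y z : nat, [/\ x < y < z, p + q + r = x + y + z &
    forall t, (t = p \/ t = q \/ t = r) -> (t = x \/ t = y \/ t = z)].
Proof.
move=> pq pr qr.
have [pq'|qp'|//] := ltngtP p q; have [pr'|rp'|//] := ltngtP p r;
  have [qr'|rq'|//] := ltngtP q r; try by lia.
- by exists p, q, r; split=> //; lia.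
- by exists p, r, q; split=> // *; lia.
- by exists r, p, q; split=> // *; lia.
- by exists q, p, r; split=> // *; lia.
- by exists q, r, p; split=> // *; lia.
- by exists r, q, p; split=> // *; lia.
Qed.

(* lo e and hi e are the extreme values of the coordinate e over the six vertices
   W e f g, attained when e comes first and last, respectively. *)
Lemma hexagon S a b c : uniq [:: a; b; c] ->
  a \notin S -> b \notin S -> c \notin S ->
  exists (W : 'I_n -> 'I_n -> 'I_n -> 'S_n) (lo hi : 'I_n -> nat),
  [/\ forall e f g, perm_eq [:: e; f; g] [:: a; b; c] ->
        [/\ W e f g \in I, kmin I (e |: S) (W e f g),
            kmin I (f |: (e |: S)) (W e f g) &
            kmin I (g |: (f |: (e |: S))) (W e f g)],
      forall e f g, perm_eq [:: e; f; g] [:: a; b; c] ->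
        [/\ xcoord (W e f g) e = lo e, xcoord (W e f g) g = hi g,
            lo f <= xcoord (W e f g) f <= hi f,
            (forall i, i \notin [:: a; b;
              c] -> xcoord (W e f g) i = xcoord (W a b c) i) &
            (forall i, i \in [:: a; b; c] -> xcoord (W e f g) i = xcoord (W a b c) a \/
              xcoord (W e f g) i = xcoord (W a b c) b \/
              xcoord (W e f g) i = xcoord (W a b c) c)] &
      minwt (b |: S) + minwt (a |: (c |: S)) =
        minn (minwt (a |: S) + minwt (b |: (c |: S)))
             (minwt (a |: (b |: S)) + minwt (c |: S)) <->
      ~ (hi a = hi c /\ hi b < hi a) /\ ~ (lo a = lo c /\ lo a < lo b)].
Proof.
move=> uabc aS bS cS; pose Q := c |: (b |: (a |: S)).
pose arr e f g := perm_eq [:: e; f; g] [:: a; b; c].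
have arrQ e f g : arr e f g -> Q = g |: (f |: (e |: S)).
  move=> /perm_mem efg; apply/setP => i; move: (efg i); rewrite !inE.
  by case: (i == a); case: (i == b); case: (i == c); case: (i == e); case: (i == f);
    case: (i == g).
have /choice[W0 W0P] : forall t : 'I_n * 'I_n * 'I_n, exists w,
    arr t.1.1 t.1.2 t.2 -> [/\ w \in I, kmin I S w /\ kmin I (t.1.1 |: S) w,
      kmin I (t.1.2 |: (t.1.1 |: S)) w, kmin I Q w &
      forall i, i \notin [:: t.1.1; t.1.2; t.2] ->
      xcoord w i = minwt (i |: before S Q i) - minwt (before S Q i)].
  (* [w0] is a dummy value for triples that are not arrangements of [a], [b], [c]. *)
  move=> [[e f] g] /=; have [efg|_] := boolP (arr e f g); last by exists w0.
  have notS i : i \in [:: e; f; g] -> i \notin S.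
    by rewrite (perm_mem efg) !inE => /or3P[]/eqP ->.
  have [|||||w wP] := @hexagon_perm S Q e f g; last by exists w.
  - by rewrite (perm_uniq efg).
  - by apply: notS; rewrite !inE eqxx.
  - by apply: notS; rewrite !inE eqxx orbT.
  - by apply: notS; rewrite !inE eqxx !orbT.
  - exact: arrQ.
pose W e f g := W0 (e, f, g).
have WP e f g : arr e f g -> [/\ W e f g \in I,
      kmin I S (W e f g) /\ kmin I (e |: S) (W e f g),
      kmin I (f |: (e |: S)) (W e f g), kmin I Q (W e f g) &
      forall i, i \notin [:: a; b; c] ->
      xcoord (W e f g) i = minwt (i |: before S Q i) - minwt (before S Q i)].
  move=> efg; have [? ? ? ? out] := W0P (e, f, g) efg; split=> // i iT.
  by apply: out; rewrite (perm_mem efg).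
have abc : arr a b c by apply: perm_refl.
pose lo e := minwt (e |: S) - minwt S; pose hi g := minwt Q - minwt (Q :\ g).
have inT e f g : arr e f g -> [/\ e \notin S, f \notin S, g \notin S & uniq [:: e;
  f; g]].
  move=> efg; have notS i : i \in [:: e; f; g] -> i \notin S.
    by rewrite (perm_mem efg) !inE => /or3P[]/eqP ->.
  by rewrite !notS ?(perm_uniq efg) ?inE ?eqxx ?orbT.
have QD e f g : arr e f g -> Q :\ g = f |: (e |: S).
  move=> efg; rewrite (arrQ _ _ _ efg) setU1K //; have [_ _ gS] := inT _ _ _ efg.
  by rewrite /= !inE !negb_or andbT => /andP[/andP[ef eg] fg];
    rewrite gS eq_sym fg eq_sym eg.
have coords e f g : arr e f g -> [/\ xcoord (W e f g) e = lo e,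
    xcoord (W e f g) g = hi g, lo f <= xcoord (W e f g) f <= hi f &
    xcoord (W e f g) e + xcoord (W e f g) f + xcoord (W e f g) g = minwt Q - minwt S].
  move=> efg; have [wI [kS keS] kfeS kQ _] := WP _ _ _ efg.
  have [eS fS gS uefg] := inT _ _ _ efg.
  have efN : f \notin e |: S.
    rewrite !inE negb_or fS andbT eq_sym.
    by move: uefg; rewrite /= !inE !negb_or => /andP[/andP[]].
  have gQ : g \notin f |: (e |: S) by rewrite -(QD _ _ _ efg) !inE eqxx.
  have wS := kminE wI kS; have weS := kminE wI keS; have wfeS := kminE wI kfeS.
  have wQ := kminE wI kQ.
  have e1 := wtU1 (W e f g) eS; have e2 := wtU1 (W e f g) efN.
  have e3 := wtU1 (W e f g) gQ; rewrite -(arrQ _ _ _ efg) in e3.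
  have e4 := wtU1 (W e f g) fS.
  have fQ : f \in Q by rewrite (arrQ _ _ _ efg) !inE eqxx orbT.
  have := wtU1 (W e f g) (_ : f \notin Q :\ f);
    rewrite setD1K // !inE eqxx => /(_ isT) e5.
  (* The middle coordinate is bounded by comparing this vertex with the minima over [f |: S] and
     [Q :\ f], which correspond to listing [f] first or last among the three. *)
  have l1 := minwt_le (f |: S) wI; have l2 := minwt_le (Q :\ f) wI.
  rewrite /lo /hi (QD _ _ _ efg); split; clear -wS weS wfeS wQ e1 e2 e3 e4 e5 l1 l2;
    lia.
have same e f g : arr e f g -> forall i, i \in [:: a; b; c] ->
    xcoord (W e f g) i = xcoord (W a b c) a \/ xcoord (W e f g) i = xcoord (W a b c)
      b \/
    xcoord (W e f g) i = xcoord (W a b c) c.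
  move=> efg i iT; have [_ _ _ _ o1] := WP _ _ _ efg; have [_ _ _ _ o2] := WP _ _ _ abc.
  have [j] := xcoord_same_values (fun i iT => etrans (o1 i iT) (esym (o2 i iT))) iT.
  by rewrite !inE => /or3P[]/eqP -> ->; auto.
exists W, lo, hi; split.
- by move=> e f g efg; have [wI [_ k1] k2 k3 _] := WP _ _ _ efg; split;
    rewrite -?(arrQ _ _ _ efg).
- move=> e f g efg; have [_ _ _ _ o1] := WP _ _ _ efg;
    have [_ _ _ _ o2] := WP _ _ _ abc.
  have [c1 c2 c3 _] := coords _ _ _ efg; split=> // [i iT|]; last exact: same.
  by rewrite o1 // o2.
have arrs : [/\ arr a c b, arr b a c & arr b c a] /\ arr c a b /\ arr c b a.
  by do !split; apply/seq.permP => p /=; clear; lia.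
have [[acb bac bca] [cab cba]] := arrs.
have inj w i j : i != j -> xcoord w i <> xcoord w j by move=> ij /xcoord_inj /eqP;
  apply/negP.
have [ab ac bc] : [/\ a != b, a != c & b != c].
  by move: uabc; rewrite /= !inE negb_or andbT => /andP[/andP[]].
have [X [Y [Z [XYZ sumE sortE]]]] := sort3 (inj (W a b c) _ _ ab) (inj (W a b c) _ _ ac)
  (inj (W a b c) _ _ bc).
have loV e f g : arr e f g -> lo e = X \/ lo e = Y \/ lo e = Z.
  move=> efg; have [<- _ _ _] := coords _ _ _ efg; apply: sortE; apply: same => //.
  by rewrite -(perm_mem efg) !inE eqxx.
have hiV e f g : arr e f g -> hi g = X \/ hi g = Y \/ hi g = Z.
  move=> efg; have [_ <- _ _] := coords _ _ _ efg; apply: sortE; apply: same => //.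
  by rewrite -(perm_mem efg) !inE eqxx !orbT.
have sQ : minwt Q - minwt S = X + Y + Z by have [_ _ _ <-] := coords _ _ _ abc.
have lohi e f g : arr e f g -> lo e <> hi g.
  move=> efg; have [<- <- _ _] := coords _ _ _ efg; apply: inj.
  by have [_ _ _] := inT _ _ _ efg; rewrite /= !inE negb_or => /andP[/andP[]].
have between e f g : arr e f g -> lo f + lo e + hi g <= X + Y + Z <= hi f + lo e + hi g.
  move=> efg; have [e1 e2 e3 e4] := coords _ _ _ efg; rewrite -sQ -e4 -e1 -e2.
  by move: e3; clear; lia.
have <- := hexagon_arith XYZ (loV _ _ _ abc) (loV _ _ _ bac) (loV _ _ _ cab)
  (hiV _ _ _ cba) (hiV _ _ _ acb) (hiV _ _ _ abc)
  (lohi _ _ _ acb) (lohi _ _ _ abc) (lohi _ _ _ bca) (lohi _ _ _ bac)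
  (lohi _ _ _ cba) (lohi _ _ _ cab)
  (between _ _ _ abc) (between _ _ _ acb) (between _ _ _ bac) (between _ _ _ bca)
  (between _ _ _ cab) (between _ _ _ cba).
(* [lo] and [hi] are truncated differences of naturals; the facts below show that nothing was
   truncated and express the minima in the relation through them. *)
have SQ : minwt S + (X + Y + Z) = minwt Q.
  have [wI [kS _] _ kQ _] := WP _ _ _ abc.
  have SltQ : minwt S <= minwt Q.
    rewrite -(kminE wI kS) -(kminE wI kQ) /Q.
    by rewrite !wtU1 ?inE ?negb_or ?cS ?bS ?aS ?(eq_sym c) ?(eq_sym b a) ?ac ?bc ?ab
      //; clear; lia.
  by rewrite -sQ subnKC.
have loE e f g : arr e f g -> minwt (e |: S) = minwt S + lo e.
  move=> efg; have [wI [kS keS] _ _ _] := WP _ _ _ efg;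
    have [eS _ _ _] := inT _ _ _ efg.
  by rewrite /lo subnKC // -(kminE wI kS) -(kminE wI keS) wtU1 // leq_addl.
have hiE e f g : arr e f g -> minwt (f |: (e |: S)) + hi g = minwt Q.
  move=> efg; have [wI _ k1 k2 _] := WP _ _ _ efg.
  have gQ : g \notin f |: (e |: S) by rewrite -(QD _ _ _ efg) !inE eqxx.
  rewrite /hi (QD _ _ _ efg) subnKC // -(kminE wI k1) -(kminE wI k2).
  by rewrite (arrQ _ _ _ efg) (wtU1 _ gQ) leq_addl.
have := loE _ _ _ abc; have := loE _ _ _ bac; have := loE _ _ _ cab.
have := hiE _ _ _ cab; have := hiE _ _ _ cba; have := hiE _ _ _ bac.
have hi_le g e f : arr e f g -> hi g <= X + Y + Z.
  by move=> efg; have := hiV _ _ _ efg; clear; lia.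
have := hi_le _ _ _ cab; have := hi_le _ _ _ cba; have := hi_le _ _ _ bac.
move: SQ; clear; move: (minwt _) (minwt Q) (minwt (b |: S)) (minwt (a |: (c |: S)))
  (minwt (a |: S)) (minwt (b |: (c |: S))) (minwt (a |: (b |: S))) (minwt (c |: S)).
move: (lo a) (lo b) (lo c) (hi a) (hi b) (hi c) (X + Y + Z).
by move=> *; lia.
Qed.

End Hexagon.

(** * The three-term relation against the two closure conditions *)

Section Closure.
Variables (n : nat) (I : {set 'S_n}) (w0 : 'S_n).
Hypotheses (gI : greedy I) (w0I : w0 \in I).
Implicit Types (S X Y U T Q : {set 'I_n}) (M : {set {set 'I_n}}).
Implicit Types (w : 'S_n) (a b c e f g i j : 'I_n).

Definition middle_closed M := forall U a b c,
  a \notin U -> b \notin U -> c \notin U -> a < b < c ->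
  a |: U \in M -> c |: U \in M -> b |: U \in M.

Definition co_middle_closed M := forall U a b c,
  a \notin U -> b \notin U -> c \notin U -> a < b < c ->
  a |: (b |: U) \in M -> b |: (c |: U) \in M -> a |: (c |: U) \in M.

Definition three_term S a b c :=
  minwt I w0 (b |: S) + minwt I w0 (a |: (c |: S)) =
    minn (minwt I w0 (a |: S) + minwt I w0 (b |: (c |: S)))
         (minwt I w0 (a |: (b |: S)) + minwt I w0 (c |: S)).

(** Some member of [I] avoids [X] at level [k], so the minimizer avoids it too, and only [Y] is
    left. *)
Lemma kmin_proj X Y w k : kmin I X w -> k <= n -> Y \in proj k @: I -> Y = ~: X ->
  proj k w = Y.
Proof.
move=> Xw kn /imsetP[w' w'I YE] YX; have := Xw k w' kn w'I.
rewrite -YE YX setICr cards0 leqn0 cards_eq0 setI_eq0 disjoint_sym disjoints_subset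
  => wY.
by apply/eqP; rewrite eqEcard wY -YX YE !card_proj //=.
Qed.

Lemma arrangements a b c : [/\ perm_eq [:: a; c; b] [:: a; b; c],
  perm_eq [:: b; a; c] [:: a; b; c], perm_eq [:: b; c; a] [:: a; b; c],
  perm_eq [:: c; a; b] [:: a; b; c] & perm_eq [:: c; b; a] [:: a; b; c]].
Proof. by split; apply/seq.permP => p /=; clear; lia. Qed.

Lemma lt3_uniq a b c : a < b < c -> [/\ uniq [:: a; b; c], a != b, a != c & b != c].
Proof.
move=> /andP[ab bc]; have ac := ltn_trans ab bc.
by rewrite /= !inE -!(inj_eq val_inj) /= !ltn_eqF.
Qed.

Definition three_term_closed := forall S a b c,
  a \notin S -> b \notin S -> c \notin S -> a < b < c -> three_term S a b c.

(** Take for [S] the complement of [U] and [a], [b], [c]. The projections [c |: U] and [a |: U]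
    appear at the vertices [W a b c] and [W b c a], so just one of the three values exceeds [n - k],
    and it equals both [hi a] and [hi c]. If [b |: U] were missing, [hi b] would be smaller, which
    the relation excludes. *)
Lemma three_term_middle_closed k : k <= n -> three_term_closed ->
  middle_closed (proj k @: I).
Proof.
move=> kn mv U a b c aU bU cU abc aM cM.
have [acb bac bca cab cba] := arrangements a b c; have [uabc ab ac bc] := lt3_uniq abc.
pose S := ~: (c |: (b |: (a |: U))).
have [aS bS cS] : [/\ a \notin S, b \notin S & c \notin S] by rewrite !inE !eqxx !orbT.
have [W [lo [hi [W1 W2 W3]]]] := hexagon gI w0I uabc aS bS cS.
have [N1 _] := W3.1 (mv S a b c aS bS cS abc).
have inj w i j : i != j -> xcoord w i <> xcoord w j.
  by move=> ij /xcoord_inj /eqP; apply/negP.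
apply/negPn/negP => bM; apply: N1.
have [_ _ k1 _] := W1 _ _ _ (perm_refl _).
have [_ _ k2 _] := W1 _ _ _ bca.
have [w2I _ _ _] := W1 _ _ _ acb.
have [_ hc _ _ _] := W2 _ _ _ (perm_refl _).
have [_ ha _ _ Va] := W2 _ _ _ bca.
have [_ hb _ out Vb] := W2 _ _ _ acb.
have pabc : proj k (W a b c) = c |: U.
  apply: kmin_proj k1 kn cM _; apply/setP => i; rewrite !inE negb_or negb_or negbK.
  case: (eqVneq i b) => [->|_]; first by rewrite (negPf bc) (negPf bU).
  by case: (eqVneq i a) => [->|_] //=; rewrite (negPf ac) (negPf aU).
have pbca : proj k (W b c a) = a |: U.
  apply: kmin_proj k2 kn aM _; apply/setP => i; rewrite !inE negb_or negb_or negbK.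
  case: (eqVneq i c) => [->|_]; first by rewrite eq_sym (negPf ac) (negPf cU).
  by case: (eqVneq i b) => [->|_] //=; rewrite eq_sym (negPf ab) (negPf bU).
have cA : (n - k < xcoord (W a b c) a) = false.
  by rewrite -proj_xcoord // pabc !inE (negPf ac) (negPf aU).
have cB : (n - k < xcoord (W a b c) b) = false.
  by rewrite -proj_xcoord // pabc !inE (negPf bc) (negPf bU).
have cC : n - k < xcoord (W a b c) c by rewrite -proj_xcoord // pabc !inE eqxx.
have cA' : n - k < xcoord (W b c a) a by rewrite -proj_xcoord // pbca !inE eqxx.
have pacb : (n - k < hi b) = false.
  apply: contraNF bM => hbk; have -> : b |: U = proj k (W a c b); last exact: imset_f.
  have pb : b \in proj k (W a c b) by rewrite proj_xcoord // hb.
  have pc : c \notin proj k (W a c b).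
    rewrite proj_xcoord //; have := Vb c.
    rewrite !inE !eqxx !orbT => /(_ isT) h1.
    have := Vb b; rewrite !inE !eqxx !orbT => /(_ isT) h2.
    have := inj (W a c b) _ _ bc; move: h1 h2 hbk; rewrite -hb.
    by move: cA cB; clear; lia.
  have pa : a \notin proj k (W a c b).
    rewrite proj_xcoord //; have := Vb a; rewrite !inE !eqxx => /(_ isT) h1.
    have := Vb b; rewrite !inE !eqxx !orbT => /(_ isT) h2.
    have := inj (W a c b) _ _ ab; move: h1 h2 hbk; rewrite -hb.
    by move: cA cB; clear; lia.
  have UP : b |: U \subset proj k (W a c b).
    rewrite subUset sub1set pb /=; apply/subsetP => i iU.
    rewrite proj_xcoord // out -?proj_xcoord // ?pabc ?inE ?iU ?orbT //.
    by rewrite !negb_or; apply/and3P; split; apply: contraTneq iU => ->.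
  have := card_proj (W a b c) kn; rewrite pabc cardsU1 cU => ck.
  by apply/eqP; rewrite eqEcard UP card_proj // cardsU1 bU ck leqnn.
have := Va a; rewrite !inE !eqxx => /(_ isT).
rewrite -hc -ha => h1; move: h1 cA cB cC cA' pacb.
by clear; lia.
Qed.

(** As before, but now two of the three values exceed [n - k]: the remaining small value is both
    [lo a] and [lo c], and [lo b] would be larger if [a |: (c |: U)] were missing. *)
Lemma three_term_co_middle_closed k : k <= n -> three_term_closed ->
  co_middle_closed (proj k @: I).
Proof.
move=> kn mv U a b c aU bU cU abc aM cM.
have [acb bac bca cab cba] := arrangements a b c; have [uabc ab ac bc] := lt3_uniq abc.
pose S := ~: (c |: (b |: (a |: U))).
have [aS bS cS] : [/\ a \notin S, b \notin S & c \notin S] by rewrite !inE !eqxx !orbT.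
have [W [lo [hi [W1 W2 W3]]]] := hexagon gI w0I uabc aS bS cS.
have [_ N2] := W3.1 (mv S a b c aS bS cS abc).
have inj w i j : i != j -> xcoord w i <> xcoord w j.
  by move=> ij /xcoord_inj /eqP; apply/negP.
apply/negPn/negP => bM; apply: N2.
have [_ k1 _ _] := W1 _ _ _ (perm_refl _).
have [_ k2 _ _] := W1 _ _ _ cab.
have [w2I _ _ _] := W1 _ _ _ bac.
have [la _ _ _ _] := W2 _ _ _ (perm_refl _).
have [lc _ _ _ Vc] := W2 _ _ _ cab.
have [lb _ _ out Vb] := W2 _ _ _ bac.
have pabc : proj k (W a b c) = b |: (c |: U).
  apply: kmin_proj k1 kn cM _; apply/setP => i; rewrite !inE negb_or negbK.
  case: (eqVneq i a) => [->|_]; first by rewrite (negPf ab) (negPf ac) (negPf aU).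
  by rewrite orbCA.
have pcab : proj k (W c a b) = a |: (b |: U).
  apply: kmin_proj k2 kn aM _; apply/setP => i; rewrite !inE negb_or negbK.
  case: (eqVneq i c) => [->|_]; last by rewrite orbCA.
  by rewrite eq_sym (negPf ac) eq_sym (negPf bc) (negPf cU).
have cA : (n - k < xcoord (W a b c) a) = false.
  by rewrite -proj_xcoord // pabc !inE (negPf ac) (negPf ab) (negPf aU).
have cB : n - k < xcoord (W a b c) b by rewrite -proj_xcoord // pabc !inE eqxx.
have cC : n - k < xcoord (W a b c) c by rewrite -proj_xcoord // pabc !inE eqxx orbT.
have cC' : (n - k < xcoord (W c a b) c) = false.
  by rewrite -proj_xcoord // pcab !inE eq_sym (negPf ac) eq_sym (negPf bc) (negPf cU).
have pbac : n - k < lo b.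
  apply: contraNT bM => lbk.
  have -> : a |: (c |: U) = proj k (W b a c); last exact: imset_f.
  have vb := Vb b; rewrite !inE !eqxx !orbT in vb; have {}vb := vb isT.
  have pc : c \in proj k (W b a c).
    rewrite proj_xcoord //; have := Vb c; rewrite !inE !eqxx !orbT => /(_ isT) h1.
    have := inj (W b a c) _ _ bc; move: h1 vb lbk; rewrite -lb.
    by move: cB cC; clear; lia.
  have pa : a \in proj k (W b a c).
    rewrite proj_xcoord //; have := Vb a; rewrite !inE !eqxx => /(_ isT) h1.
    have := inj (W b a c) _ _ ab; move: h1 vb lbk; rewrite -lb.
    by move: cB cC; clear; lia.
  have UP : a |: (c |: U) \subset proj k (W b a c).
    rewrite !subUset !sub1set pa pc /=; apply/subsetP => i iU.
    rewrite proj_xcoord // out -?proj_xcoord // ?pabc ?inE ?iU ?orbT //.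
    by rewrite !negb_or; apply/and3P; split; apply: contraTneq iU => ->.
  have := card_proj (W a b c) kn; rewrite pabc !cardsU1 !inE negb_or bc bU cU => ck.
  by apply/eqP; rewrite eqEcard UP card_proj // !cardsU1 !inE negb_or ac aU cU ck leqnn.
have := Vc c; rewrite !inE !eqxx !orbT => /(_ isT).
rewrite -la -lc => h1; move: h1 cA cB cC cC' pbac.
by clear; lia.
Qed.

Lemma middle_closed_three_term :
  (forall k, 1 <= k <= n ->
     middle_closed (proj k @: I) /\ co_middle_closed (proj k @: I)) ->
  three_term_closed.
Proof.
move=> closed S a b c aS bS cS abc.
have [acb bac bca cab cba] := arrangements a b c; have [uabc ab ac bc] := lt3_uniq abc.
have [W [lo [hi [W1 W2 W3]]]] := hexagon gI w0I uabc aS bS cS.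
have inj w i j : i != j -> xcoord w i <> xcoord w j.
  by move=> ij /xcoord_inj /eqP; apply/negP.
have notT i : i \notin [:: a; b; c] -> [/\ i != a, i != b & i != c].
  by rewrite !inE !negb_or => /and3P.
have inT i : i \notin [:: a; b; c] \/ i = a \/ i = b \/ i = c.
  have [|] := boolP (i \in [:: a; b; c]); last by left.
  by rewrite !inE => /or3P[]/eqP ->; auto.
apply/W3; split=> [[hac hba]|[lac lab]].
  have [w1I _ _ _] := W1 _ _ _ bca; have [w2I _ _ _] := W1 _ _ _ (perm_refl _).
  have [w3I _ k3 _] := W1 _ _ _ acb.
  have [lb1 ha1 c1 out1 _] := W2 _ _ _ bca.
  have [la2 hc2 c2 _ _] := W2 _ _ _ (perm_refl _).
  have [_ hb3 c3 out3 V3] := W2 _ _ _ acb.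
  have [_ _ cb _ _] := W2 _ _ _ cba.
  have hab := inj (W a b c) _ _ ac; have hac1 := inj (W b c a) _ _ ac.
  have [_ _ ca _ _] := W2 _ _ _ bac.
  have nhi := xcoord_le (W a b c) c.
  (* At this level a projection consists of the coordinates that are at least [hi a]. *)
  pose k := (n - hi a).+1; have kn : k <= n by move: nhi; rewrite /k hac -hc2;
    clear; lia.
  have nk : n - k = (hi a).-1 by move: nhi; rewrite /k hac -hc2; clear; lia.
  have hk x : (n - k < x) = (hi a <= x) by rewrite nk; move: hba; clear; lia.
  pose U := proj k (W b c a) :\ a.
  have inU i : i \notin [:: a; b; c] -> (i \in U) = (hi a <= xcoord (W a b c) i).
    by move=> iT; have [ia _ _] := notT i iT; rewrite !inE ia proj_xcoord // hk out1.
  have aU : a \notin U by rewrite !inE eqxx.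
  have bU : b \notin U.
    by rewrite !inE negb_and negbK proj_xcoord // hk; move: lb1 cb hba; clear; lia.
  have cU : c \notin U.
    rewrite !inE negb_and negbK proj_xcoord // hk; move: ha1 hac1 c1 hac.
    by clear; lia.
  have aM : a |: U \in proj k @: I.
    rewrite setD1K ?imset_f // proj_xcoord // hk ha1 leqnn //.
  have cM : c |: U \in proj k @: I.
    rewrite (_ : c |: U = proj k (W a b c)) ?imset_f //.
    apply/setP => i; rewrite in_setU1 proj_xcoord // hk.
    have [iT|[|[|]] ->] := inT i.
    - by have [_ _ ic] := notT i iT; rewrite (negPf ic) inU.
    - by rewrite (negPf ac) (negPf aU) /=; move: hab hc2 hac ca la2; clear; lia.
    - by rewrite (negPf bc) (negPf bU) /=; move: c2 hba; clear; lia.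
    - by rewrite eqxx hc2 hac leqnn.
  have kP : 1 <= k <= n by rewrite kn.
  have /imsetP[w' w'I bE] := (closed k kP).1 U a b c aU bU cU abc aM cM.
  (* [W a c b] is optimal for [c |: (a |: S)]. Since [hi b < hi a], its large value sits at [a] or
     [c], whereas [w'] has it at [b] and so meets that set in fewer elements. *)
  have := k3 k w' kn w'I; rewrite leqNgt => /negP; apply; rewrite -bE.
  have bL : b \notin c |: (a |: S) by rewrite !inE (negPf bc) eq_sym (negPf ab).
  have sub : (c |: (a |: S)) :&: (b |: U) \subset (c |: (a |: S)) :&: proj k (W a c b).
    apply/subsetP => i /setIP[iL]; rewrite in_setI iL in_setU1 => /orP[/eqP ib|iU].
      by rewrite ib (negPf bL) in iL.
    have iT : i \notin [:: a; b; c].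
      by rewrite !inE !negb_or; apply/and3P; split; apply: contraTneq iU => ->.
    by rewrite proj_xcoord // hk out3 // -inU.
  apply: proper_card; apply/properP; split=> //.
  have Va := V3 a; have Vb := V3 b; have Vc := V3 c.
  rewrite !inE !eqxx !orbT in Va Vb Vc.
  have {}Va := Va isT; have {}Vb := Vb isT; have {}Vc := Vc isT.
  have [] : hi a <= xcoord (W a c b) a \/ hi a <= xcoord (W a c b) c.
  - have := inj (W a c b) _ _ ab; have := inj (W a c b) _ _ ac.
    have := inj (W a c b) _ _ bc; move: Va Vb Vc hc2 hac hb3 hba.
    by clear; lia.
  - exists a; first by rewrite !inE eqxx ?orbT proj_xcoord // hk.
    by rewrite !in_setI !in_setU1 (negPf ab) (negPf aU) andbF.
  - exists c; first by rewrite !inE eqxx ?orbT proj_xcoord // hk.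
    by rewrite !in_setI !in_setU1 (eq_sym c b) (negPf bc) (negPf cU) andbF.
have [w1I _ _ _] := W1 _ _ _ (perm_refl _); have [w2I _ _ _] := W1 _ _ _ cba.
have [w3I k3 _ _] := W1 _ _ _ bac.
have [la1 hc1 c1 _ _] := W2 _ _ _ (perm_refl _).
have [lc2 ha2 c2 out2 _] := W2 _ _ _ cba.
have [lb3 _ _ out3 _] := W2 _ _ _ bac.
have [_ _ ca _ _] := W2 _ _ _ bac; have [_ _ cc _ _] := W2 _ _ _ acb.
have hab := inj (W a b c) _ _ ac; have hac1 := inj (W c b a) _ _ ac.
have nlo := xcoord_le (W a b c) a; have nlob := xcoord_le (W b a c) b.
(* Now projections collect the coordinates strictly above [lo a]. The vertex [W b a c], optimal for
   [b |: S], has [b] in its projection because [lo a < lo b]; the closure condition yields a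
   competitor without [b]. *)
pose k := n - lo a; have kn : k <= n by rewrite leq_subr.
have nk : n - k = lo a by move: nlo; rewrite /k -la1; clear; lia.
have kP : 1 <= k <= n by rewrite kn andbT /k; move: nlob lab; rewrite lb3; clear; lia.
pose U := proj k (W a b c) :\ b :\ c.
have inU i : i \notin [:: a; b; c] -> (i \in U) = (lo a < xcoord (W a b c) i).
  by move=> iT; have [_ ib ic] := notT i iT; rewrite !inE ib ic proj_xcoord // nk.
have bU : b \notin U by rewrite !inE eqxx andbF.
have cU : c \notin U by rewrite !inE eqxx.
have aU : a \notin U by rewrite !inE proj_xcoord // nk la1 ltnn !andbF.
have bcM : b |: (c |: U) \in proj k @: I.
  rewrite setD1K ?setD1K ?imset_f //.
    by rewrite proj_xcoord // nk; move: c1 lab; clear; lia.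
  rewrite !inE eq_sym bc proj_xcoord // nk; move: hab hc1 la1 lac cc.
  by clear; lia.
have abM : a |: (b |: U) \in proj k @: I.
  rewrite (_ : a |: (b |: U) = proj k (W c b a)) ?imset_f //.
  apply/setP => i; rewrite !in_setU1 proj_xcoord // nk.
  have [iT|[|[|]] ->] := inT i.
  - by have [ia ib _] := notT i iT; rewrite (negPf ia) (negPf ib) inU // out2.
  - by rewrite eqxx /=; move: hac1 lc2 lac ca ha2; clear; lia.
  - by rewrite eqxx orbT /=; move: c2 lab; clear; lia.
  - by rewrite eq_sym (negPf ac) eq_sym (negPf bc) (negPf cU) lc2 lac ltnn.
have /imsetP[w' w'I bE] := (closed k kP).2 U a b c aU bU cU abc abM bcM.
have := k3 k w' kn w'I; rewrite leqNgt => /negP; apply; rewrite -bE.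
apply: proper_card; apply/properP; split.
  apply/subsetP => i /setIP[iL];
    rewrite in_setI iL !in_setU1 => /or3P[/eqP ib|/eqP ib|iU].
  - by rewrite ib !inE (negPf ab) (negPf aS) in iL.
  - by rewrite ib !inE eq_sym (negPf bc) (negPf cS) in iL.
  have iT : i \notin [:: a; b; c].
    by rewrite !inE !negb_or; apply/and3P; split; apply: contraTneq iU => ->.
  by rewrite proj_xcoord // nk out3 // -inU.
exists b; first by rewrite !inE eqxx proj_xcoord // nk lb3.
by rewrite !in_setI !in_setU1 (eq_sym b a) (negPf ab) (negPf bc) (negPf bU) andbF.
Qed.

End Closure.

(** * Polytopes and their edges *)

Section Polytope.
Import Order.TTheory GRing.Theory Num.Theory.
Local Open Scope classical_set_scope.
Local Open Scope ring_scope.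
Variables (R : realType) (n : nat).
Implicit Types (A F : set 'rV[R]_n) (x y z c d v : 'rV[R]_n).

Lemma dotC c x : dot c x = dot x c.
Proof. by apply: eq_bigr => i _; rewrite mulrC. Qed.

Lemma dotDr c x y : dot c (x + y) = dot c x + dot c y.
Proof. by rewrite /dot -big_split; apply: eq_bigr => i _; rewrite !mxE mulrDr. Qed.

Lemma dotZr c (t : R) x : dot c (t *: x) = t * dot c x.
Proof. by rewrite /dot mulr_sumr; apply: eq_bigr => i _; rewrite !mxE mulrCA. Qed.

Lemma dot0r c : dot c (0 : 'rV[R]_n) = 0.
Proof. by rewrite -(scale0r (0 : 'rV_n)) dotZr mul0r. Qed.

Lemma dotNr c x : dot c (- x) = - dot c x.
Proof. by rewrite -scaleN1r dotZr mulN1r. Qed.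

Lemma dotBr c x y : dot c (x - y) = dot c x - dot c y.
Proof. by rewrite dotDr dotNr. Qed.

Lemma dotDl c d x : dot (c + d) x = dot c x + dot d x.
Proof. by rewrite ![dot _ x]dotC dotDr. Qed.

Lemma dotZl (t : R) c x : dot (t *: c) x = t * dot c x.
Proof. by rewrite ![dot _ x]dotC dotZr. Qed.

Lemma dotNl c x : dot (- c) x = - dot c x.
Proof. by rewrite ![dot _ x]dotC dotNr. Qed.

Lemma dotBl c d x : dot (c - d) x = dot c x - dot d x.
Proof. by rewrite dotDl dotNl. Qed.

Lemma dot_ge0 x : 0 <= dot x x.
Proof. by apply: sumr_ge0 => i _; rewrite -expr2 sqr_ge0. Qed.

Lemma dot_eq0 x : (dot x x == 0) = (x == 0).
Proof.
apply/eqP/eqP => [|->]; last by rewrite /dot big1 // => i _; rewrite mxE mul0r.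
move/eqP; rewrite psumr_eq0 => [/allP x0|i _]; last by rewrite -expr2 sqr_ge0.
apply/rowP => i; rewrite mxE; have := x0 i; rewrite mem_index_enum => /(_ isT).
by rewrite mulf_eq0 orbb => /eqP.
Qed.

Lemma dot_gt0 x : x != 0 -> 0 < dot x x.
Proof. by rewrite lt_def dot_ge0 andbT dot_eq0. Qed.

Lemma sphere_line x v (t : R) : v != 0 -> dot (x + v) (x + v) = dot x x ->
  dot (x + t *: v) (x + t *: v) = dot x x -> t = 0 \/ t = 1.
Proof.
move=> /dot_gt0; rewrite !dotDl !dotDr !dotZl !dotZr [dot v x]dotC.
set s := dot x v; set q := dot v v => q0 e1 e2.
have e0 : s + s + q = 0 by lra.
have e3 : t * (s + s + q) = 0 by rewrite e0 mulr0.
have tq : t * (t - 1) * q = 0 by lra.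
move/eqP: tq; rewrite !mulf_eq0 (gt_eqF q0) orbF subr_eq0.
by case/orP => /eqP tE; [left | right].
Qed.

Lemma sub_hull A : A `<=` hull A.
Proof. exact: sub_gen_smallest. Qed.

Lemma hull_dot_ge A d (m : R) :
  (forall a, A a -> m <= dot d a) -> forall p, hull A p -> m <= dot d p.
Proof.
move=> Am; suff : hull A `<=` [set p | m <= dot d p] by move=> CA p /CA.
apply: smallest_sub => //.
apply/(@convex_setW R 'rV[R]_n) => p q /set_mem mp /set_mem mq k k0 k1.
apply/mem_set; rewrite /conv /=; set l := k%:num in k0 k1 *.
have l1 : 0 < 1 - l by rewrite subr_gt0.
rewrite /unstable.onem dotDr !dotZr.
have -> : m = l * m + (1 - l) * m by rewrite mulrBl mul1r addrC subrK.
by apply: lerD; rewrite ler_pM2l.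
Qed.

(** The hull is available only as the smallest convex set, so the claim is made membership in a
    convex set [C]. A proper convex combination attains the lower bound [m] only if both end points
    do, and then both lie on the line. *)
Lemma hull_face A d v x (m : R) :
  (forall a, A a -> m <= dot d a) ->
  (forall a, A a -> dot d a = m -> exists t : R, a = x + t *: v) ->
  forall p, hull A p -> dot d p = m -> exists t : R, p = x + t *: v.
Proof.
move=> Am Ax; pose C : set 'rV[R]_n :=
  [set p | m <= dot d p /\ (dot d p = m -> exists t : R, p = x + t *: v)].
suff CA : hull A `<=` C by move=> p /CA[].
apply: smallest_sub; last by move=> a Aa; split; [apply: Am | apply: Ax].
apply/(@convex_setW R 'rV[R]_n) => p q /set_mem[mp pl] /set_mem[mq ql] k k0 k1.
apply/mem_set; rewrite /conv /=; set l := k%:num in k0 k1 *.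
have l1 : 0 < 1 - l by rewrite subr_gt0.
rewrite /C /= /unstable.onem dotDr !dotZr; split.
  have -> : m = l * m + (1 - l) * m by rewrite mulrBl mul1r addrC subrK.
  by apply: lerD; rewrite ler_pM2l.
move=> eqm; have [p_m q_m] : dot d p = m /\ dot d q = m.
  have h1 : l * m <= l * dot d p by rewrite ler_pM2l.
  have h2 : (1 - l) * m <= (1 - l) * dot d q by rewrite ler_pM2l.
  have e1 : l * dot d p = l * m by lra.
  have e2 : (1 - l) * dot d q = (1 - l) * m by lra.
  by split; [apply: (mulfI (lt0r_neq0 k0)) | apply: (mulfI (lt0r_neq0 l1))].
have [t ->] := pl p_m; have [s ->] := ql q_m; exists (l * t + (1 - l) * s).
by apply/rowP => i; rewrite !mxE; ring.
Qed.

Lemma aff_dim_line F x v : v != 0 -> F x -> F (x + v) ->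
  (forall p, F p -> exists t : R, p = x + t *: v) -> aff_dim F = 1%N.
Proof.
move=> v0 Fx Fxv Fl; apply/eqP; rewrite eqn_leq; apply/andP; split.
  apply/bigmax_leqP => d /asboolP[y [M [Fy FM freeM]]].
  have [s ys] := Fl _ Fy.
  have /choice[t tP] : forall i, exists t : R, row i M = t *: v.
    move=> i; have [r] := Fl _ (FM i); rewrite ys -addrA => /addrI rE.
    by exists (r - s); rewrite scalerBl -rE addrAC subrr add0r.
  have -> : d = \rank M :> nat by apply/eqP; rewrite eq_sym.
  have -> : M = (\col_i t i) *m v.
    apply/row_matrixP => i; rewrite tP row_mul; apply/rowP => j.
    by rewrite !mxE big_ord1 !mxE.
  by rewrite (leq_trans (mxrankM_maxr _ _)) // rank_rV; case: (v != 0).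
have n0 : (1 < n.+1)%N.
  rewrite ltnS lt0n; apply: contraNneq v0 => n0; apply/eqP/rowP => -[j jn].
  by exfalso; move: jn; rewrite n0.
apply: (leq_trans _ (@leq_bigmax_cond _ _ _ (Ordinal n0) _)) => //.
apply/asboolP; exists x, v; split=> //; last by rewrite /row_free rank_rV v0.
by move=> i; rewrite (_ : row i v = v) // row_id.
Qed.

Lemma aff_dim1_collinear F x y z : aff_dim F = 1%N -> F x -> F y -> F z -> y != x ->
  exists t : R, z = x + t *: (y - x).
Proof.
move=> F1 Fx Fy Fz yx; apply: contrapT => nline.
have yx0 : y - x != 0 by rewrite subr_eq0.
have free : row_free (col_mx (y - x) (z - x)).
  apply: inj_row_free => u; rewrite -[u]hsubmxK mul_row_col.
  rewrite [lsubmx u]mx11_scalar [rsubmx u]mx11_scalar !mul_scalar_mx.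
  set a := lsubmx u 0 0; set b := rsubmx u 0 0 => ab.
  have b0 : b = 0.
    apply/eqP; apply: contraPT nline => b0; apply; exists (- (a / b)).
    have e : b *: (z - x) = - (a *: (y - x)) by apply/eqP; rewrite -addr_eq0 addrC ab.
    rewrite -[LHS](subrK x) addrC; congr (_ + _); apply: (scalerI b0).
    by rewrite e scalerA mulrN mulrCA divff // mulr1 scaleNr.
  move: ab; rewrite b0 scale0r addr0 => /eqP;
    rewrite scaler_eq0 (negPf yx0) orbF => /eqP ->.
  by rewrite !raddf0 row_mx0.
have n2 : (2 < n.+1)%N.
  by rewrite ltnS -[X in (X <= _)%N](eqP free) rank_leq_col.
have : (2 <= aff_dim F)%N; last by rewrite F1.
apply: (leq_trans _ (@leq_bigmax_cond _ _ _ (Ordinal n2) _)) => //.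
apply/asboolP; exists x, (col_mx (y - x) (z - x)); split=> //.
suff rows (i : 'I_(1 + 1)) : F (x + row i (col_mx (y - x) (z - x))) by apply: rows.
by case: (split_ordP i) => j ->; rewrite ?rowKu ?rowKd row_id addrC subrK.
Qed.

Lemma aff_dim_point F x : (forall y, F y -> y = x) -> aff_dim F = 0%N.
Proof.
move=> Fx; apply/eqP; rewrite -leqn0;
  apply/bigmax_leqP => d /asboolP[y [M [/Fx -> FM]]].
move=> /eqP <-; rewrite leqn0 mxrank_eq0; apply/eqP/row_matrixP => i.
by rewrite row0; apply: (addrI x); rewrite addr0; apply: Fx.
Qed.

End Polytope.

(** * Twisted points on a common sphere *)

Section TwistedPoints.
Import Order.TTheory GRing.Theory Num.Theory.
Local Open Scope classical_set_scope.
Local Open Scope ring_scope.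
Variables (R : realType) (n : nat) (I : {set 'S_n}).
Implicit Types (w z : 'S_n) (c d : 'rV[R]_n).
Local Notation pt := (@twisted_point R n).

Definition points_hull : set 'rV[R]_n := hull [set pt w | w in [set` I]].

Lemma twisted_pointE w i : pt w 0 i = (xcoord w i)%:R.
Proof. by rewrite mxE -natrB ?subSS // ltnS ltnW. Qed.

Lemma hull_pt w : w \in I -> points_hull (pt w).
Proof. by move=> wI; apply: sub_hull; exists w. Qed.

Lemma twisted_point_inj : injective pt.
Proof.
move=> w z wz; apply: invg_inj; apply/permP => i.
have := congr1 (fun x : 'rV[R]_n => x 0 i) wz; rewrite /= !twisted_pointE => /eqP.
rewrite eqr_nat /xcoord; case: (w^-1%g i) (z^-1%g i) => [p pn] [q qn] /= e.
by apply: val_inj => /=; move: pn qn e; clear; lia.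
Qed.

Lemma twisted_point_norm w z : dot (pt w) (pt w) = dot (pt z) (pt z).
Proof.
suff E (x : 'S_n) : dot (pt x) (pt x) = \sum_(p < n) ((n - p)%:R * (n - p)%:R) by
  rewrite !E.
rewrite (reindex_inj (@perm_inj _ x^-1%g)); apply: eq_bigr => i _.
by rewrite twisted_pointE.
Qed.

(** Two distinct points of one sphere. Consequently [- pt w] is minimized over the twisted points
    only at [w]; it is the strictly positive reference functional [d0] of the perturbations
    below. *)
Lemma dot_pt_lt w z : z != w -> dot (pt w) (pt z) < dot (pt w) (pt w).
Proof.
move=> zw; have := dot_gt0 (_ : pt z - pt w != 0).
rewrite subr_eq0 (inj_eq twisted_point_inj) => /(_ zw).
rewrite dotBl !dotBr (twisted_point_norm z w) [dot (pt z) (pt w)]dotC; lra.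
Qed.

Lemma collinear_points w z y (t : R) : z != w ->
  pt y = pt w + t *: (pt z - pt w) -> y = w \/ y = z.
Proof.
move=> zw yE; have zE : pt w + (pt z - pt w) = pt z by rewrite addrC subrK.
have [|||t0|t1] := @sphere_line R n (pt w) (pt z - pt w) t.
- by rewrite subr_eq0 (inj_eq twisted_point_inj).
- by rewrite zE; apply: twisted_point_norm.
- by rewrite -yE; apply: twisted_point_norm.
- by left; apply: twisted_point_inj; rewrite yE t0 scale0r addr0.
- by right; apply: twisted_point_inj; rewrite yE t1 scale1r.
Qed.

End TwistedPoints.

(** * Finding an improving edge by perturbing functionals *)

Section ImprovingEdges.
Import Order.TTheory GRing.Theory Num.Theory.
Local Open Scope classical_set_scope.
Local Open Scope ring_scope.
Variables (R : realType) (n : nat) (I : {set 'S_n}).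
Implicit Types (w z y : 'S_n) (c d e : 'rV[R]_n).
Local Notation pt := (@twisted_point R n).
Local Notation P := (@points_hull R n I).

Lemma hull_ge d m : (forall w, w \in I -> m <= dot d (pt w)) ->
  forall p, P p -> m <= dot d p.
Proof. by move=> Im; apply: hull_dot_ge => _ [w wI <-]; apply: Im. Qed.

Definition face d : set 'rV[R]_n :=
  [set p | P p /\ forall q, P q -> dot d p <= dot d q].

Lemma face_pt d w : w \in I -> (forall z, z \in I -> dot d (pt w) <= dot d (pt z)) ->
  face d (pt w).
Proof. by move=> wI dw; split; [apply: hull_pt | apply: hull_ge]. Qed.

Lemma face_sub_line d w v p : w \in I ->
  (forall z, z \in I -> dot d (pt w) <= dot d (pt z)) ->
  (forall z, z \in I -> dot d (pt z) = dot d (pt w) ->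
    exists t : R, pt z = pt w + t *: v) ->
  face d p -> exists t : R, p = pt w + t *: v.
Proof.
move=> wI dw dv [Pp pmin]; apply: (@hull_face R n _ d v (pt w) (dot d (pt w)) _ _ p Pp).
- by move=> _ [z zI <-]; apply: dw.
- by move=> _ [z zI <-]; apply: dv.
by apply/eqP; rewrite eq_le (pmin _ (hull_pt wI)) (hull_ge dw Pp).
Qed.

Definition ties d w : {set 'S_n} := [set z in I | dot d (pt z - pt w) == 0].

Lemma face_edge d w z : z \in I -> w \in I -> z != w ->
  (forall y, y \in I -> 0 <= dot d (pt y - pt w)) ->
  ties d w = [set w; z]%SET -> is_edge P (face d).
Proof.
move=> zI wI zw dpos tE.
have dw y : y \in I -> dot d (pt w) <= dot d (pt y).
  by move=> /dpos; rewrite dotBr subr_ge0.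
have dz : dot d (pt z) = dot d (pt w).
  have : z \in ties d w by rewrite tE !inE eqxx orbT.
  by rewrite inE zI dotBr subr_eq0 => /eqP.
have Fw : face d (pt w) by apply: face_pt.
have Fz : face d (pt w + (pt z - pt w)).
  rewrite addrC subrK; split=> [|q Pq]; first exact: hull_pt.
  by rewrite dz; apply: Fw.2.
split; first by split; [exists (pt w) | exists d].
apply: aff_dim_line Fw Fz _;
  first by rewrite subr_eq0 (inj_eq (@twisted_point_inj R n)).
move=> p; apply: face_sub_line => // y yI dy.
have : y \in ties d w by rewrite inE yI dotBr dy subrr eqxx.
rewrite tE !inE => /orP[]/eqP ->; first by exists 0; rewrite scale0r addr0.
by exists 1; rewrite scale1r addrC subrK.
Qed.

(** Add to [c] the least multiple of [d0] that makes it nonnegative at [w]; the factor is the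
    maximal ratio [rho z1], so [z1] becomes a tie. The factor is nonnegative thanks to [z0], so on
    ties [c] is a nonpositive multiple of [d0]. *)
Lemma start_direction c w z0 : z0 \in I -> z0 != w ->
  dot c (pt z0) <= dot c (pt w) ->
  exists d, [/\ forall y, y \in I -> 0 <= dot d (pt y - pt w),
    exists2 y, y \in ties d w & y != w &
    forall y, y \in ties d w -> dot c (pt y - pt w) <= 0].
Proof.
move=> z0I z0w cz0; pose A := I :\ w.
have z0A : z0 \in A by rewrite !inE z0w.
pose d0 := - pt w.
have d0_gt0 y : y != w -> 0 < dot d0 (pt y - pt w).
  by move=> yw; rewrite dotNl dotBr opprB subr_gt0 dot_pt_lt.
pose rho y := - dot c (pt y - pt w) / dot d0 (pt y - pt w).
have [z1 z1A zmax] := @arg_maxP _ R _ z0 (mem A) rho z0A.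
have rhoE y : y != w -> dot c (pt y - pt w) = - rho y * dot d0 (pt y - pt w).
  by move=> yw; rewrite /rho -!mulNr opprK divfK // lt0r_neq0 // d0_gt0.
have dE y : y != w -> dot (c + rho z1 *: d0) (pt y - pt w) =
    dot d0 (pt y - pt w) * (rho z1 - rho y).
  move=> yw; rewrite dotDl dotZl; have := rhoE y yw.
  by move: (dot d0 (pt y - pt w)) => u ->; ring.
have rho_ge0 : 0 <= rho z1.
  apply: le_trans (zmax _ z0A); apply: divr_ge0; last exact/ltW/d0_gt0.
  by rewrite dotBr opprB subr_ge0.
exists (c + rho z1 *: d0); split.
- move=> y yI; have [->|yw] := eqVneq y w; first by rewrite subrr dot0r.
  rewrite dE // mulr_ge0 //; first exact/ltW/d0_gt0.
  by rewrite subr_ge0; apply: zmax; change (y \in A); rewrite !inE yw.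
- have : z1 \in A := z1A; rewrite !inE => /andP[z1w z1I]; exists z1 => //.
  by rewrite inE z1I dE // subrr mulr0 eqxx.
- move=> y; rewrite inE => /andP[yI].
  have [->|yw] := eqVneq y w; first by rewrite subrr !dot0r.
  rewrite dE // mulf_eq0 (gt_eqF (d0_gt0 _ yw)) /= subr_eq0 => /eqP rE.
  by rewrite rhoE // -rE mulNr oppr_le0 mulr_ge0 // ltW // d0_gt0.
Qed.

(** The explicit step [(1 + s)^-1] keeps [eta * |g t|] below [f t] for all [t] at once. *)
Lemma small_step (T : finType) (A : {set T}) (f g : T -> R) :
  (forall t, t \in A -> 0 < f t) ->
  exists2 eta : R, 0 < eta & forall t, t \in A -> 0 < f t + eta * g t.
Proof.
move=> fpos; pose s := \sum_(t in A) (`|g t| / f t).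
have s0 : 0 <= s by apply: sumr_ge0 => t tA; rewrite divr_ge0 // ltW // fpos.
exists (1 + s)^-1; first by rewrite invr_gt0; lra.
move=> t tA; have ft := fpos t tA.
have gs : `|g t| < (1 + s) * f t.
  rewrite -ltr_pdivrMr //; apply: (@le_lt_trans _ _ s); last by lra.
  rewrite /s (bigD1 t) //= lerDl; apply: sumr_ge0 => i /andP[iA _].
  by rewrite divr_ge0 // ltW // fpos.
rewrite -(pmulr_rgt0 _ (_ : 0 < 1 + s)); last by lra.
rewrite mulrDr mulrA divff ?mul1r; last by apply/eqP; lra.
by have := ler_norm (- g t); rewrite normrN; lra.
Qed.

(* Perturb d by a small multiple of e - rho v *: d0, which is nonnegative on the
   ties of d, vanishes at w and v, and is not zero at both y and z. *)
Lemma smaller_ties d w y z : y \in ties d w -> z \in ties d w ->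
  (forall y, y \in I -> 0 <= dot d (pt y - pt w)) ->
  y != w -> z != w -> y != z ->
  exists d', [/\ forall y, y \in I -> 0 <= dot d' (pt y - pt w),
    exists2 y, y \in ties d' w & y != w & ties d' w \proper ties d w].
Proof.
move=> yT zT dpos yw zw yz; pose x u := pt u - pt w.
pose d0 := - pt w.
have d0_gt0 u : u != w -> 0 < dot d0 (x u).
  by move=> uw; rewrite dotNl dotBr opprB subr_gt0 dot_pt_lt.
(* [e] is nonzero because [w], [y], [z] are not collinear. It is built so that [rho y = rho z] would
   give [dot e e = 0]; hence [y] and [z] cannot both remain ties. *)
pose e := dot d0 (x y) *: x z - dot d0 (x z) *: x y.
have e0 : e != 0.
  apply/eqP => e0; have dy := lt0r_neq0 (d0_gt0 y yw).
  have xz : x z = (dot d0 (x z) / dot d0 (x y)) *: x y.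
    apply: (scalerI dy); rewrite scalerA mulrCA divff // mulr1.
    by apply/eqP; rewrite -subr_eq0 -/e e0.
  have [] := @collinear_points R n w y z (dot d0 (x z) / dot d0 (x y)) yw.
  - by rewrite -xz addrC subrK.
  - by move=> zw'; rewrite zw' eqxx in zw.
  - by move=> zy; rewrite zy eqxx in yz.
pose rho u := dot e (x u) / dot d0 (x u).
pose A := ties d w :\ w.
have yA : y \in A by rewrite in_setD1 yw.
have [v vA vmin] := @arg_minP _ R _ y (mem A) rho yA.
pose e' := e - rho v *: d0.
have x0 f : dot f (x w) = 0 by rewrite /x subrr dot0r.
have e'E u : u != w -> dot e' (x u) = dot d0 (x u) * (rho u - rho v).
  move=> uw; rewrite dotBl dotZl mulrBr /rho [dot d0 (x u) * (_ / _)]mulrC.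
  by rewrite divfK ?lt0r_neq0 ?d0_gt0 // [dot d0 (x u) * _]mulrC.
have [|eta eta0 etaP] := @small_step _ (I :\: ties d w)
  (fun u => dot d (x u)) (fun u => dot e' (x u)).
  move=> u; rewrite !inE negb_and => /andP[+ uI]; rewrite uI /= => ne.
  by rewrite lt_def ne dpos.
have d'E u : dot (d + eta *: e') (x u) = dot d (x u) + eta * dot e' (x u).
  by rewrite dotDl dotZl.
have e'_ge0 u : u \in ties d w -> 0 <= dot e' (x u).
  move=> uT; have [->|uw] := eqVneq u w; first by rewrite x0.
  rewrite e'E // mulr_ge0 //; first exact/ltW/d0_gt0.
  by rewrite subr_ge0; apply: vmin; change (u \in A); rewrite in_setD1 uw.
have d'T u : u \in ties d w -> dot (d + eta *: e') (x u) = eta * dot e' (x u).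
  by rewrite inE d'E => /andP[_ /eqP ->]; rewrite add0r.
exists (d + eta *: e'); split.
- move=> u uI; rewrite -/(x u); have [uT|uT] := boolP (u \in ties d w).
    by rewrite d'T // mulr_ge0 ?e'_ge0 // ltW.
  by rewrite d'E ltW // etaP // inE uT.
- have [vw vT] : v != w /\ v \in ties d w by have : v \in A := vA;
    rewrite in_setD1 => /andP[].
  exists v => //; rewrite inE -/(x v) d'T // e'E // subrr !mulr0 eqxx andbT.
  by move: vT; rewrite inE => /andP[].
apply/properP; split.
  apply/fintype.subsetP => u; rewrite [u \in ties (_ + _) _]inE -/(x u) => /andP[uI uE].
  apply/negPn/negP => uT; have := etaP u; rewrite inE uT uI => /(_ isT).
  by rewrite -d'E (eqP uE) ltxx.
have [neq|] := eqVneq (rho y) (rho v); last first.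
  move=> neq; exists y => //; rewrite inE -/(x y) d'T // e'E // !mulf_eq0.
  by rewrite (gt_eqF eta0) (gt_eqF (d0_gt0 _ yw)) subr_eq0 (negPf neq) andbF.
exists z => //; rewrite inE -/(x z) d'T // e'E // !mulf_eq0 -neq.
rewrite (gt_eqF eta0) (gt_eqF (d0_gt0 _ zw)) subr_eq0 /=.
apply/negP => /andP[_ /eqP rE]; have := dot_gt0 e0.
rewrite {2}/e dotBr !dotZr.
have -> : dot e (x z) = rho z * dot d0 (x z) by rewrite /rho divfK // lt0r_neq0 //
  d0_gt0.
have -> : dot e (x y) = rho y * dot d0 (x y) by rewrite /rho divfK // lt0r_neq0 //
  d0_gt0.
by rewrite rE [_ * (_ * dot d0 (x y))]mulrCA [dot d0 (x z) * _]mulrC mulrCA subrr ltxx.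
Qed.

(* Among the functionals that are minimal over I at w, are tied there with
   another point, and have only ties not worse than w for c, one with the fewest
   ties has exactly two, and so exposes an edge. *)
Lemma improving_edge c w z0 : w \in I -> z0 \in I -> z0 != w ->
  dot c (pt z0) <= dot c (pt w) ->
  exists z F, [/\ z \in I, z != w, dot c (pt z) <= dot c (pt w) &
    [/\ is_edge P F, F (pt w) & F (pt z)]].
Proof.
move=> wI z0I z0w cz0; have [d [d1 d2 d3]] := start_direction z0I z0w cz0.
have [m] := ubnP #|ties d w|; elim: m d d1 d2 d3 => // m IHm d d1 [z zT zw] d3 dm.
have zI : z \in I by move: zT; rewrite inE => /andP[].
have dw y : y \in I -> dot d (pt w) <= dot d (pt y).
  by move=> /d1; rewrite dotBr subr_ge0.
have [E|] := eqVneq (ties d w) [set w; z]%SET.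
  exists z, (face d); split=> //; first by have := d3 _ zT; rewrite dotBr subr_le0.
  split; [exact: (face_edge zI wI zw d1 E) | exact: face_pt |].
  apply: face_pt => // y yI; apply: le_trans (dw _ yI).
  by move: zT; rewrite inE zI dotBr subr_eq0 /= => /eqP ->.
move=> nE; have wT : w \in ties d w by rewrite inE wI subrr dot0r eqxx.
have [y] : exists y, y \in ties d w :\: [set w; z]%SET.
  apply/finset.set0Pn; rewrite finset.setD_eq0; apply: contraNN nE => sub.
  by rewrite finset.eqEsubset sub finset.subUset !finset.sub1set wT zT.
rewrite !inE negb_or -!andbA => /and4P[yw yz yI yE].
have yT : y \in ties d w by rewrite inE yI.
have [d' [d'1 d'2 lt]] := smaller_ties yT zT d1 yw zw yz.
apply: (IHm d' d'1 d'2) => [u uT|]; last exact: leq_trans (proper_card lt) dm.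
exact: d3 (fintype.subsetP (proper_sub lt) _ uT).
Qed.

End ImprovingEdges.

(** * Effect of exchanging two values *)

Section Swap.
Variable n : nat.
Implicit Types (S : {set 'I_n}) (w z : 'S_n) (i j : 'I_n) (d : 'I_n -> nat).

Lemma xcoord_ext w z : xcoord w =1 xcoord z -> w = z.
Proof.
move=> wz; apply: invg_inj; apply/permP => i; move: (wz i); rewrite /xcoord.
case: (w^-1%g i) (z^-1%g i) => [p pn] [q qn] /= e.
by apply: val_inj => /=; move: pn qn e; clear; lia.
Qed.

Lemma xcoord_swap w z i j : i != j -> z != w ->
  (forall l, l != i -> l != j -> xcoord z l = xcoord w l) ->
  xcoord z i = xcoord w j /\ xcoord z j = xcoord w i.
Proof.
move=> ij zw out.
have outT l : l \notin [:: i; j] -> xcoord z l = xcoord w l.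
  by rewrite !inE negb_or => /andP[]; apply: out.
have [a aT zi] := xcoord_same_values outT (mem_head i [:: j]).
have [b bT zj] := xcoord_same_values outT (mem_last i [:: j]).
have neq : xcoord z i <> xcoord z j by move=> /xcoord_inj /eqP; apply/negP.
move: aT bT; rewrite !inE => /orP[]/eqP ea /orP[]/eqP eb; rewrite ea in zi;
  rewrite eb in zj.
- by rewrite zi zj in neq.
- case/eqP: zw; apply: xcoord_ext => l.
  by have [->|li] := eqVneq l i; last have [->|lj] := eqVneq l j; last exact: out.
- by [].
- by rewrite zi zj in neq.
Qed.

Lemma card_proj_sum S w k : k <= n ->
  #|S :&: proj k w| = \sum_(l in S) (n - k < xcoord w l).
Proof.
move=> kn; rewrite -sum1_card big_mkcond [RHS]big_mkcond; apply: eq_bigr => l _.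
by rewrite inE proj_xcoord //; case: (l \in S) => //=; case: (n - k < _).
Qed.

(** The exchange puts the smaller value at [i], the earlier index for [d]. An initial set containing
    [j] contains [i], so only sets with [i] alone are affected, and they can only lose. *)
Lemma swap_initial w z i j d S k : k <= n -> i != j ->
  (forall l, l != i -> l != j -> xcoord z l = xcoord w l) ->
  xcoord z i = xcoord w j -> xcoord z j = xcoord w i -> xcoord w j < xcoord w i ->
  d i < d j -> initial d S -> #|S :&: proj k z| <= #|S :&: proj k w|.
Proof.
move=> kn ij out zi zj ltw dij Sd; rewrite !card_proj_sum //.
have [iS|iS] := boolP (i \in S); last first.
  have jS : j \notin S by apply/negP => jS; have := Sd j i jS iS; rewrite ltnNge ltnW.
  apply: leq_sum => l lS; rewrite out //; first by apply: contraNneq iS => <-.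
  by apply: contraNneq jS => <-.
rewrite (big_setD1 i iS) [in leqRHS](big_setD1 i iS) /=.
have [jS|jS] := boolP (j \in S).
  have jS' : j \in S :\ i by rewrite !inE eq_sym ij.
  rewrite (big_setD1 j jS') [in leqRHS](big_setD1 j jS') /= zi zj addnCA leq_add2l.
  rewrite leq_add2l; apply: leq_sum => l; rewrite !inE => /and3P[lj li _].
  by rewrite out.
apply: leq_add; first by rewrite zi; move: ltw; clear; lia.
apply: leq_sum => l; rewrite !inE => /andP[li lS]; rewrite out //.
by apply: contraNneq jS => <-.
Qed.

Lemma swap_weight w z i j d : i != j ->
  (forall l, l != i -> l != j -> xcoord z l = xcoord w l) ->
  xcoord z i = xcoord w j -> xcoord z j = xcoord w i -> d i < d j ->
  \sum_l d l * xcoord w l <= \sum_l d l * xcoord z l ->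
  xcoord w j < xcoord w i /\ \sum_l d l * xcoord w l < \sum_l d l * xcoord z l.
Proof.
move=> ij out zi zj dij; have ji : j != i by rewrite eq_sym.
rewrite (bigD1 i) // (bigD1 j) //= [in leqRHS](bigD1 i) // [in leqRHS](bigD1 j) //=.
rewrite [X in _ -> _ /\ _ < X](bigD1 i) // [X in _ -> _ /\ _ < _ + X](bigD1 j) //=.
rewrite [X in _ <= _ + (_ + X)](eq_bigr (fun l => d l * xcoord w l)); last first.
  by move=> l /andP[li lj]; rewrite out.
rewrite [X in _ -> _ /\ _ < _ + (_ + X)](eq_bigr (fun l => d l * xcoord w l));
  last first.
  by move=> l /andP[li lj]; rewrite out.
rewrite !addnA leq_add2r ltn_add2r zi zj.
have neq : xcoord w i <> xcoord w j by move=> /xcoord_inj /eqP; apply/negP.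
by move: (xcoord w i) (xcoord w j) (d i) (d j) neq dij; clear; nia.
Qed.

End Swap.

(** * From generalized permutahedra to greedy sets *)

Section GeneralizedPermutahedron.
Import Order.TTheory GRing.Theory Num.Theory.
Local Open Scope classical_set_scope.
Local Open Scope ring_scope.
Variables (R : realType) (n : nat) (I : {set 'S_n}) (w0 : 'S_n).
Hypothesis w0I : w0 \in I.
Implicit Types (w z y : 'S_n) (c d e : 'rV[R]_n) (S : {set 'I_n}).
Local Notation pt := (@twisted_point R n).
Local Notation P := (@points_hull R n I).

Lemma mu_minwt S : mu P S = (minwt I w0 S)%:R.
Proof.
pose c : 'rV[R]_n := \row_i (i \in S)%:R.
have dotc (x : 'rV[R]_n) : dot c x = \sum_(i in S) x 0 i.
  rewrite [RHS]big_mkcond; apply: eq_bigr => i _; rewrite mxE.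
  by case: (i \in S); rewrite ?mul1r ?mul0r.
have wtE w : dot c (pt w) = (wt S w)%:R.
  by rewrite dotc natr_sum; apply: eq_bigr => i _; rewrite twisted_pointE.
have lb p : P p -> (minwt I w0 S)%:R <= dot c p.
  by apply: hull_ge => w wI; rewrite wtE ler_nat minwt_le.
have [w1 w1I w1E] : exists2 w, w \in I & wt S w = minwt I w0 S.
  by rewrite /minwt; case: arg_minnP => // w wI _; exists w.
apply: xget_unique.
  split; first by exists (pt w1); [exact: hull_pt | rewrite -dotc wtE w1E].
  by move=> _ [x Px <-]; rewrite -dotc; apply: lb.
move=> m [[x Px <-] xlb]; apply/eqP; rewrite eq_le -{2}dotc lb // andbT.
by apply: xlb; exists (pt w1); [exact: hull_pt | rewrite -dotc wtE w1E].
Qed.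

Lemma three_termP S i j k :
  mu P (j |: S) + mu P (i |: (k |: S)) =
    Num.min (mu P (i |: S) + mu P (j |: (k |: S)))
            (mu P (i |: (j |: S)) + mu P (k |: S)) <->
  three_term I w0 S i j k.
Proof.
rewrite !mu_minwt -!natrD -natr_min; split=> [/eqP|->]; last by rewrite minEnat.
by rewrite eqr_nat minEnat => /eqP.
Qed.

(* Each edge of P exchanges two values, so the edges improving a generic
   functional also improve all rank functions of initial sets at once. *)
Lemma generalized_permutahedron_greedy : generalized_permutahedron P -> greedy I.
Proof.
move=> [_ gpP] d dI; pose val (w : 'S_n) := (\sum_l d l * xcoord w l)%N.
have [w wI wmax] := @arg_maxnP _ w0 (mem I) val w0I.
exists w => // S k w' Sd kn w'I.
have [m] := ubnP (val w - val w')%N; elim: m w' w'I => // m IHm w' w'I lt_m.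
have [-> //|w'w] := eqVneq w' w.
pose c : 'rV[R]_n := \row_l - (d l)%:R.
have dotc y : dot c (pt y) = - (val y)%:R.
  rewrite natr_sum -sumrN; apply: eq_bigr => l _.
  by rewrite mxE twisted_pointE natrM mulNr.
have [||z [F [zI zw' cz [Fe Fw' Fz]]]] := @improving_edge R n I c w' w w'I wI.
- by rewrite eq_sym.
- by rewrite !dotc lerN2 ler_nat; apply: wmax.
have [i [j [ij par]]] := gpP F Fe.
have out l : l != i -> l != j -> xcoord z l = xcoord w' l.
  have [t tE] := par _ _ Fw' Fz => li lj; apply/eqP;
    rewrite -(eqr_nat R) -!twisted_pointE.
  have /eqP := congr1 (fun x : 'rV[R]_n => x 0 l) tE.
  by rewrite !mxE (negPf li) (negPf lj) !andbF subrr mulr0 subr_eq0.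
have [zi zj] := xcoord_swap ij zw' out.
have valz : (val w' <= val z)%N by move: cz; rewrite !dotc lerN2 ler_nat.
wlog dij : i j ij {par} out zi zj / (d i < d j)%N => [H|].
  have [dij|dji|/dI eq_ij] := ltngtP (d i) (d j); first exact: (H i j).
    by apply: (H j i) => //; [rewrite eq_sym | move=> l li lj; apply: out].
  by rewrite eq_ij eqxx in ij.
(* The edge improves [val] only weakly; since [d] separates [i] and [j], the gain is strict and the
   induction advances. *)
have [ltw lt_val] := swap_weight ij out zi zj dij valz.
apply: leq_trans (swap_initial kn ij out zi zj ltw dij Sd).
apply: IHm => //; have : (val z <= val w)%N by apply: wmax.
by move: lt_m lt_val; rewrite -/(val w') -/(val z); clear; lia.
Qed.

End GeneralizedPermutahedron.

(** * Abel summation over level sets *)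

Section Layers.
Import Order.TTheory GRing.Theory Num.Theory.
Local Open Scope ring_scope.
Variables (R : realType) (n : nat).
Implicit Types (c Z : 'I_n -> R) (S : {set 'I_n}).

Definition strict_upper c S := forall i j, i \in S -> j \notin S -> c j < c i.

(** Unlike a strict upper set, such a set may cut through one level of [c]. *)
Definition upper c S := forall i j, i \in S -> j \notin S -> c j <= c i.

(* Abel summation, by induction: lowering the top value of c to the next one
   changes the sum by a multiple of the sum of Z over the top level. *)
Lemma strict_upper_sum c Z : \sum_i Z i = 0 ->
  (forall S, strict_upper c S -> 0 <= \sum_(i in S) Z i) ->
  0 <= \sum_i c i * Z i /\
  (\sum_i c i * Z i = 0 -> forall S, strict_upper c S -> \sum_(i in S) Z i = 0).
Proof.
move=> Z0; have [m] := ubnP #|[set p : 'I_n * 'I_n | c p.1 < c p.2]|.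
elim: m c => // m IHm c lt_m Zc.
have [/existsP[[i0 j0] /= ij0]|] := boolP [exists p : 'I_n * 'I_n, c p.1 < c p.2];
  last first.
  rewrite negb_exists => /forallP const.
  have cc i j : c i = c j.
    by apply/eqP; rewrite eq_le !leNgt (const (i, j)) (const (j, i)).
  have -> : \sum_i c i * Z i = 0.
    have [i _|noI] := pickP 'I_n; last by rewrite big1 // => i; have := noI i.
    by rewrite (eq_bigr (fun j => c i * Z j)) -?mulr_sumr ?Z0 ?mulr0 // => j _;
      rewrite (cc j i).
  split=> // _ S Su; have [->|[i iS]] := set_0Vmem S; first by rewrite big_set0.
  rewrite -[RHS]Z0; apply: eq_bigl => j; apply/negPn/negP => jS.
  by have := Su i j iS jS; rewrite (cc j i) ltxx.
have [t _ tmax] := @arg_maxP _ R _ i0 xpredT c isT.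
pose top := [set i | c i == c t].
have i0top : i0 \notin top.
  by rewrite inE lt_eqF // (lt_le_trans ij0) //; apply: tmax.
have [s stop smax] := @arg_maxP _ R _ i0 [pred i | i \notin top] c i0top.
have lt_st : c s < c t.
  by rewrite lt_def; move: stop; rewrite /= inE eq_sym => ->; apply: tmax.
pose c' i := if i \in top then c s else c i.
have c'_le i : c' i <= c s.
  by rewrite /c'; have [//|itop] := boolP (i \in top); apply: smax.
have c'_lec i : c' i <= c i.
  by rewrite /c'; case: ifP => //; rewrite inE => /eqP ->; apply: ltW.
have topU : strict_upper c top.
  move=> i j; rewrite !inE => /eqP -> jt; rewrite lt_def eq_sym jt; exact: tmax.
have c'E : \sum_i c i * Z i = \sum_i c' i * Z i + (c t - c s) * \sum_(i in top) Z i.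
  rewrite mulr_sumr [X in _ + X]big_mkcond -big_split; apply: eq_bigr => i _ /=.
  rewrite /c'; case: ifP => [|_]; last by rewrite addr0.
  by rewrite inE => /eqP ->; rewrite mulrBl addrC subrK.
have c'U S : strict_upper c' S -> strict_upper c S.
  move=> Su i j iS jS; have ji := Su i j iS jS; apply: lt_le_trans (c'_lec i).
  suff -> : c j = c' j by [].
  rewrite /c'; case: ifP => // jtop; move: ji; rewrite {1}/c' jtop.
  by rewrite ltNge c'_le.
have [|c'0 c'Z] := IHm c' _ (fun S Su => Zc S (c'U S Su)).
  rewrite -ltnS; apply: leq_trans lt_m; rewrite ltnS; apply: proper_card;
    apply/properP; split.
    apply/fintype.subsetP => -[i j]; rewrite !inE /= => ij.
    apply: lt_le_trans (c'_lec j); suff -> : c i = c' i by [].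
    rewrite /c'; case: ifP => // itop; move: ij; rewrite {1}/c' itop.
    by rewrite ltNge c'_le.
  exists (s, t); rewrite inE //= /c'.
  have -> : t \in top by rewrite inE.
  by move: stop; rewrite /= => /negPf ->; rewrite ltxx.
have Ztop := Zc top topU; have pos : 0 < c t - c s by rewrite subr_gt0.
have topZ := mulr_ge0 (ltW pos) Ztop; split; first by rewrite c'E addr_ge0.
move=> /eqP; rewrite c'E paddr_eq0 // => /andP[/eqP c'eq].
rewrite mulf_eq0 (gt_eqF pos) /= => /eqP Ztop0 S Su.
have [->|S0] := eqVneq S finset.set0; first by rewrite big_set0.
have [->//|Stop] := eqVneq S top.
apply: c'Z => // i j iS jS.
have subS : top \subset S.
  apply/fintype.subsetP => k ktop; apply/negPn/negP => kS.
  have := Su i k iS kS; rewrite inE in ktop; rewrite (eqP ktop) ltNge.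
  by rewrite (tmax i isT : c i <= c t).
have jtop : j \notin top by apply: contraNN jS => /(fintype.subsetP subS).
rewrite {1}/c' (negPf jtop) /c'; case: ifP => itop; last exact: Su.
have [k kS ktop] : exists2 k, k \in S & k \notin top.
  apply/fintype.subsetPn; apply: contraNN Stop => Ssub.
  by rewrite finset.eqEsubset Ssub.
by apply: lt_le_trans (Su k j kS jS) _; apply: smax.
Qed.

End Layers.

(** * From greedy sets to generalized permutahedra *)

Section GreedyPolytope.
Import Order.TTheory GRing.Theory Num.Theory.
Local Open Scope classical_set_scope.
Local Open Scope ring_scope.
Variables (R : realType) (n : nat) (I : {set 'S_n}).
Hypothesis gI : greedy I.
Implicit Types (w z x y : 'S_n) (c d e : 'rV[R]_n) (S : {set 'I_n}).
Local Notation pt := (@twisted_point R n).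
Local Notation P := (@points_hull R n I).

Lemma sum_xcoord w z : (\sum_l xcoord w l = \sum_l xcoord z l)%N.
Proof.
suff E (u : 'S_n) : (\sum_l xcoord u l = \sum_(p < n) (n - p))%N by rewrite !E.
by rewrite [RHS](reindex_inj (@perm_inj _ u^-1%g)).
Qed.

Lemma greedy_chain (c : 'I_n -> R) S1 S2 : upper c S1 -> upper c S2 -> S1 \subset S2 ->
  exists2 w, w \in I & forall u, u \in I ->
    [/\ (wt S1 w <= wt S1 u)%N, (wt S2 w <= wt S2 u)%N &
      forall S, strict_upper c S -> (wt S w <= wt S u)%N].
Proof.
move=> u1 u2 S12; pose r i := #|[set j | c i < c j]%SET|.
have r_le i j : c j <= c i -> (r i <= r j)%N.
  move=> ji; apply: subset_leq_card; apply/fintype.subsetP => k; rewrite !inE.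
  exact: le_lt_trans.
have r_lt i j : c j < c i -> (r i < r j)%N.
  move=> ji; apply: proper_card; apply/properP; split.
    apply/fintype.subsetP => k; rewrite !inE; exact: lt_trans.
  by exists i; rewrite inE // ltxx.
(* Large values of [c] come first; within a level, [S1] precedes the rest of [S2], which precedes
   everything else. These three classes explain the factor 3. *)
pose l i := (r i * 3 + ((i \notin S1) + (i \notin S2)))%N.
have dI : injective (fun i : 'I_n => (l i * n + i)%N).
  move=> i j eq_ij; apply: val_inj => /=.
  by have := congr1 (modn^~ n) eq_ij; rewrite !modnMDl !modn_small.
have d_lt (i j : 'I_n) : (l i < l j)%N -> (l i * n + i < l j * n + j)%N.
  move=> lij; apply: (@leq_trans (l i * n + n)%N); first by rewrite ltn_add2l.
  by rewrite -mulSnr (leq_trans _ (leq_addr _ _)) // leq_mul2r lij orbT.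
have [w wI wmin] := gI dI; exists w => // u uI.
have wt_le S : (forall i j, i \in S -> j \notin S -> (l i < l j)%N) ->
  (wt S w <= wt S u)%N.
  move=> Sl; apply: (@kmin_wt n I) => // k w' kn w'I; apply: wmin => // i j iS jS.
  by apply: d_lt; apply: Sl.
split.
- apply: wt_le => i j iS jS; have := r_le i j (u1 i j iS jS).
  rewrite /l iS (negPf jS) (fintype.subsetP S12 _ iS) /=; clear; lia.
- apply: wt_le => i j iS jS; have := r_le i j (u2 i j iS jS).
  have jS1 : j \notin S1 by apply: contraNN jS => /(fintype.subsetP S12).
  by rewrite /l iS jS jS1 /=; case: (i \notin S1); clear; lia.
move=> S Su; apply: wt_le => i j iS jS; have := r_lt i j (Su i j iS jS).
by rewrite /l; case: (i \notin S1); case: (i \notin S2); case: (j \notin S1);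
  case: (j \notin S2); clear; lia.
Qed.

(** For a chain of two upper sets the greedy member is optimal for [c], hence is [x] or [y], so the
    sums of [zz = y - x] over the two sets cannot have opposite signs. Testing this on chains that
    separate single coordinates leaves only two nonzero ones. *)
Lemma greedy_edge_direction c x y : x \in I -> y \in I -> y != x ->
  (forall w, w \in I -> dot c (pt x) <= dot c (pt w)) ->
  dot c (pt y) = dot c (pt x) ->
  (forall w, w \in I -> dot c (pt w) = dot c (pt x) -> w = x \/ w = y) ->
  exists i j (t : R), i != j /\ pt y - pt x = t *: (delta_mx 0 i - delta_mx 0 j).
Proof.
move=> xI yI yx xmin cy only; pose b i := c 0 i.
pose zz i : R := (xcoord y i)%:R - (xcoord x i)%:R.
have sum_diff S u w : \sum_(i in S) ((xcoord u i)%:R - (xcoord w i)%:R : R) =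
    (wt S u)%:R - (wt S w)%:R.
  by rewrite sumrB -!natr_sum.
have total u w : \sum_i ((xcoord u i)%:R - (xcoord w i)%:R : R) = 0.
  by rewrite sumrB -!natr_sum (sum_xcoord u w) subrr.
have dot_diff u w : \sum_i b i * ((xcoord u i)%:R - (xcoord w i)%:R) =
    dot c (pt u) - dot c (pt w).
  rewrite -dotBr; apply: eq_bigr => i _; congr (_ * _).
  by rewrite -!twisted_pointE !mxE.
have chain S1 S2 : upper b S1 -> upper b S2 -> S1 \subset S2 ->
    (forall S, strict_upper b S -> \sum_(i in S) zz i = 0) /\
    ((0 <= \sum_(i in S1) zz i /\ 0 <= \sum_(i in S2) zz i) \/
     (\sum_(i in S1) zz i <= 0 /\ \sum_(i in S2) zz i <= 0)).
  move=> u1 u2 S12; have [w wI wmin] := greedy_chain u1 u2 S12.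
  have opt u : u \in I -> dot c (pt u) = dot c (pt x) ->
      dot c (pt w) = dot c (pt x) /\
      forall S, strict_upper b S -> (wt S u)%:R = (wt S w)%:R :> R.
    move=> uI ux; have [|ge0 eq0] := strict_upper_sum (total u w) (c := b).
      by move=> S Su; rewrite sum_diff subr_ge0 ler_nat; have [_ _] := wmin u uI; apply.
    have wu : dot c (pt w) = dot c (pt x).
      by apply/eqP; rewrite eq_le xmin // andbT -ux -subr_ge0 -dot_diff.
    split=> // S Su; apply/eqP; rewrite -subr_eq0 -sum_diff; apply/eqP.
    by apply: eq0 => //; rewrite dot_diff ux wu subrr.
  have [wx eqx] := opt x xI erefl; have [_ eqy] := opt y yI cy.
  split=> [S Su|]; first by rewrite sum_diff eqx // eqy // subrr.
  rewrite !sum_diff !subr_ge0 !subr_le0 !ler_nat.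
  have [<-|<-] := only w wI wx; [left | right].
    by have [? ? _] := wmin y yI.
  by have [? ? _] := wmin x xI.
have upper0 : upper b finset.set0 by move=> i j; rewrite inE.
have [blocks _] := chain _ _ upper0 upper0 (fintype.subxx _).
pose K k : {set 'I_n} := [set l | b k < b l]%SET.
have KS k : \sum_(l in K k) zz l = 0.
  by apply: blocks => i j; rewrite !inE -leNgt => ki jk; apply: le_lt_trans jk ki.
have kK k l : b l <= b k -> l \notin K k by rewrite inE -leNgt.
have [i1 i1P] : exists i, zz i != 0.
  apply/existsP; apply: contraNT yx; rewrite negb_exists => /forallP zz0.
  apply/eqP/xcoord_ext => l; apply/eqP; rewrite -(eqr_nat R) -subr_eq0.
  by have := zz0 l; rewrite negbK.
pose B : {set 'I_n} := [set l | b l == b i1]%SET.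
have BS : \sum_(l in B) zz l = 0.
  have : \sum_(l in [set l | b i1 <= b l]%SET) zz l = 0.
    apply: blocks => i j; rewrite !inE -ltNge => ii ji; exact: lt_le_trans ji ii.
  rewrite (big_setID (K i1)) /= (_ : _ :&: K i1 = K i1)%SET; last first.
    by apply/finset.setP => l; rewrite !inE andb_idl // => /ltW.
  rewrite KS add0r (_ : _ :\: K i1 = B)%SET //.
  by apply/finset.setP => l; rewrite !inE -leNgt eq_le andbC.
have i1B : i1 \in B by rewrite inE.
have [l /andP[lB zl]] : exists l, (l \in B) && (zz l < 0).
  apply/existsP; apply: contraNT i1P; rewrite negb_exists => /forallP pos.
  have posB l : l \in B -> 0 <= zz l by move=> lB; have := pos l; rewrite lB /= -leNgt.
  move/eqP: BS; rewrite psumr_eq0 // => /allP /(_ i1).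
  by rewrite mem_index_enum i1B; apply.
have [i /andP[iB zi]] : exists i, (i \in B) && (0 < zz i).
  apply/existsP; apply: contraNT i1P; rewrite negb_exists => /forallP neg.
  have negB k : k \in B -> 0 <= - zz k.
    by move=> kB; have := neg k; rewrite kB /= -leNgt oppr_ge0.
  move/eqP: BS; rewrite -oppr_eq0 -sumrN psumr_eq0 // => /allP /(_ i1).
  by rewrite mem_index_enum i1B oppr_eq0; apply.
have li : b l = b i by move: lB iB; rewrite !inE => /eqP -> /eqP ->.
have neq_il : i != l by apply: contraTneq zi => ->; rewrite -leNgt ltW.
have upperK k S : (forall j, j \in S -> b k <= b j) -> K k \subset S -> upper b S.
  move=> Sk KS' j h jS hS; apply: le_trans (Sk j jS); rewrite leNgt.
  by apply: contraNN hS => kh; apply: (fintype.subsetP KS'); rewrite inE.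
have sumU1 k S : k \notin S -> \sum_(h in k |: S) zz h = zz k + \sum_(h in S) zz h.
  by move=> kS; rewrite big_setU1.
have K_le k j : j \in K k -> b k <= b j by rewrite inE => /ltW.
pose U1 := l |: K i; pose U2 := i |: K i; pose U12 := i |: U1.
have lK : l \notin K i by rewrite kK // li.
have iK : i \notin K i by rewrite kK.
have iU1 : i \notin U1 by rewrite !inE negb_or neq_il -leNgt lexx.
have U1S : \sum_(h in U1) zz h = zz l by rewrite sumU1 // KS addr0.
have U2S : \sum_(h in U2) zz h = zz i by rewrite sumU1 // KS addr0.
have U12S : \sum_(h in U12) zz h = zz i + zz l by rewrite sumU1 // U1S.
have u1 : upper b U1.
  apply: (upperK i); last exact: finset.subsetUr.
  by move=> j /finset.setU1P[->|/K_le //]; rewrite li.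
have u2 : upper b U2.
  apply: (upperK i); last exact: finset.subsetUr.
  by move=> j /finset.setU1P[->|/K_le //].
have u12 : upper b U12.
  apply: (upperK i); last by apply/fintype.subsetP => j jK; rewrite !in_setU1 jK !orbT.
  by move=> j /finset.setU1P[->//|/finset.setU1P[->|/K_le //]]; rewrite li.
(* [U12] contains both [U1], with negative sum, and [U2], with positive sum; its own sum must
   therefore vanish. *)
have zil : zz i + zz l = 0.
  have [_ s1] := chain _ _ u1 u12 (finset.subsetU1 _ _).
  have sub2 : U2 \subset U12 by rewrite /U2 /U12 finset.setUS // finset.subsetU1.
  have [_ s2] := chain _ _ u2 u12 sub2.
  by rewrite U1S U2S U12S in s1 s2; lra.
exists i, l, (zz i); split=> //.
have zk k : k != i -> k != l -> zz k = 0.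
  move=> ki kl.
  (* A set comparable with both [U1] and [U2] has sum zero by the same argument. Such a [T] with sum
     [zz k] exists whether the level of [k] is below, above or equal to that of [i]. *)
  suff [T [Tu TS Tsub]] : exists T :
    {set 'I_n}, [/\ upper b T, \sum_(h in T) zz h = zz k &
      (T \subset U1 /\ T \subset U2) \/ (U1 \subset T /\ U2 \subset T)].
    have [[s1 s2]|[s1 s2]] := Tsub.
      have [_ e1] := chain _ _ Tu u1 s1; have [_ e2] := chain _ _ Tu u2 s2.
      by rewrite TS U1S U2S in e1 e2; lra.
    have [_ e1] := chain _ _ u1 Tu s1; have [_ e2] := chain _ _ u2 Tu s2.
    by rewrite TS U1S U2S in e1 e2; lra.
  have TkS : \sum_(h in k |: K k) zz h = zz k by rewrite sumU1 ?KS ?addr0 // kK.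
  have Tku : upper b (k |: K k).
    apply: (upperK k); last exact: finset.subsetUr.
    by move=> j /finset.setU1P[->//|/K_le].
  have [lt_ki|lt_ik|eq_ki] := ltgtP (b k) (b i).
  - exists (k |: K k); split=> //; right.
    have KK : K i \subset k |: K k.
      apply/fintype.subsetP => j; rewrite !inE => ij.
      by rewrite (lt_trans lt_ki ij) orbT.
    by rewrite !finset.subUset !finset.sub1set KK !inE li lt_ki !orbT.
  - exists (k |: K k); split=> //; left.
    have KK : k |: K k \subset K i.
      apply/fintype.subsetP => j; rewrite !inE => /orP[/eqP ->//|].
      exact: lt_trans.
    by split; apply: fintype.subset_trans KK (finset.subsetU1 _ _).
  - exists (k |: U12); split.
    + apply: (upperK i).
        by move=> j /finset.setU1P[->|/finset.setU1P[->|/finset.setU1P[->|/K_le]]]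
          //; rewrite ?eq_ki ?li.
      apply/fintype.subsetP => j jK; rewrite !in_setU1 jK !orbT //.
    + by rewrite sumU1 ?U12S ?zil ?addr0 // !inE !negb_or ki kl -leNgt eq_ki lexx.
    + right; split; apply/fintype.subsetP => j; rewrite !in_setU1.
        by move=> /orP[] ->; rewrite !orbT.
      by move=> /orP[] ->; rewrite !orbT.
apply/rowP => k; have ->
  : (pt y - pt x) 0 k = zz k by rewrite /zz -!twisted_pointE !mxE.
rewrite !mxE; case: (eqVneq k i) => [->|ki].
  by rewrite (negPf neq_il) subr0 mulr1.
case: (eqVneq k l) => [->|kl]; last by rewrite zk // subrr mulr0.
by rewrite sub0r mulrN1; lra.
Qed.

Lemma greedy_generalized_permutahedron w0 : w0 \in I ->
  lattice_generalized_permutahedron P.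
Proof.
move=> w0I; split; last first.
  move=> p [_ [c cE]]; pose f (w : 'S_n) := dot c (pt w).
  have [w wI wmin] := @arg_minP _ R _ w0 (mem I) f w0I.
  have : face I c (pt w) by apply: face_pt.
  rewrite /face -cE => <- i; rewrite twisted_pointE; exact: rpred_nat.
split.
  exists [set pt w | w in [set` I]]; split=> //; last by exists (pt w0); exists w0.
  by apply: finite_image; apply: finite_finset.
move=> F [[F0 [c FE]] F1]; pose f (w : 'S_n) := dot c (pt w).
have [x xI xmin] := @arg_minP _ R _ w0 (mem I) f w0I.
have xmin' w : w \in I -> dot c (pt x) <= dot c (pt w) by move=> wI; apply: xmin.
have FE' : F = face I c by [].
have inF w : w \in I -> dot c (pt w) = dot c (pt x) -> F (pt w).
  by move=> wI e; rewrite FE'; apply: face_pt => // z zI; rewrite e; apply: xmin'.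
have [y /and3P[yI yx /eqP cy]] :
    exists y, [&& y \in I, y != x & dot c (pt y) == dot c (pt x)].
  apply/existsP; apply: contraPT F1; rewrite negb_exists => /forallP none.
  rewrite (@aff_dim_point R n F (pt x)) // => p; rewrite FE' => Fp.
  have [t ->] : exists t : R, p = pt x + t *: 0; last by rewrite scaler0 addr0.
  apply: face_sub_line xI xmin' _ Fp => z zI cz; exists 0; rewrite scaler0 addr0.
  by have := none z; rewrite zI cz eqxx andbT negbK => /eqP ->.
(* A face of dimension one lies on a line, and a line meets the sphere in at most two points. *)
have only w : w \in I -> dot c (pt w) = dot c (pt x) -> w = x \/ w = y.
  move=> wI cw; have yxp : pt y != pt x by rewrite (inj_eq (@twisted_point_inj R n)).
  have [t wE] := aff_dim1_collinear F1 (inF x xI erefl) (inF y yI cy) (inF w wI cw) yxp.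
  exact: collinear_points yx wE.
have [i [j [t [ij yxE]]]] := greedy_edge_direction xI yI yx xmin' cy only.
exists i, j; split=> //.
have line p : F p -> exists s : R, p = pt x + s *: (delta_mx 0 i - delta_mx 0 j).
  rewrite FE'; apply: face_sub_line => // z zI /(only z zI) [->|->].
    by exists 0; rewrite scale0r addr0.
  by exists t; rewrite -yxE addrC subrK.
move=> p q /line[s ->] /line[s' ->]; exists (s' - s).
by rewrite opprD addrACA subrr add0r scalerBl.
Qed.

End GreedyPolytope.

(** * Gale intervals satisfy the closure conditions *)

Section GaleIntervals.
Variables (n k : nat) (A B : {set 'I_n}).
Hypotheses (Ak : #|A| = k) (Bk : #|B| = k).

Lemma gale_interval_middle_closed : middle_closed (gale_interval k A B).
Proof.
move=> U a b c aU bU cU /andP[ab bc].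
move=> /(mem_gale_interval _ Ak Bk)[cardU aM] /(mem_gale_interval _ Ak Bk)[_ cM].
apply/(mem_gale_interval _ Ak Bk); split.
  by rewrite -cardU !cardsU1 aU bU.
move=> j; have := aM j; have := cM j; rewrite !cntU1 //.
by move: (cnt U j) (cnt A j) (cnt B j) ab bc; clear; lia.
Qed.

Lemma gale_interval_co_middle_closed : co_middle_closed (gale_interval k A B).
Proof.
move=> U a b c aU bU cU /andP[ab bc].
have [ba bc' ac] : [/\ a \notin b |: U, b \notin c |: U & a \notin c |: U].
  rewrite !inE -!(inj_eq val_inj) /= !negb_or aU bU !ltn_eqF //.
  exact: ltn_trans bc.
move=> /(mem_gale_interval _ Ak Bk)[cardU aM] /(mem_gale_interval _ Ak Bk)[_ cM].
apply/(mem_gale_interval _ Ak Bk); split.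
  by rewrite -cardU !cardsU1 ac ba bU cU.
move=> j; have := aM j; have := cM j; rewrite !cntU1 //.
by move: (cnt U j) (cnt A j) (cnt B j) ab bc; clear; lia.
Qed.

End GaleIntervals.

Theorem corollary1p1 (R : realType) (n : nat) (u v : 'S_n)
    (huv : bruhat_le u v) :
  MV_polytope (twisted_bruhat_interval_polytope R u v) <->
  (forall k : nat, 1 <= k <= n ->
     proj k @: bruhat_interval u v = gale_interval k (proj k u) (proj k v)).
Proof.
rewrite (_ : twisted_bruhat_interval_polytope R u v = @points_hull R n
  (bruhat_interval u v)) //.
set I := bruhat_interval u v.
have uI : u \in I by rewrite inE huv andbT; apply: connect0.
have vI : v \in I by rewrite inE huv; apply: connect0.
split=> [[[gpP _] mvP] k /andP[k1 kn]|gale].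
  have gI := generalized_permutahedron_greedy uI gpP.
  have closed : three_term_closed I u.
    by move=> S a b c aS bS cS abc; apply/(three_termP R uI); apply: mvP.
  have galeP S := mem_gale_interval S (card_proj u kn) (card_proj v kn).
  apply/setP => S; apply/idP/idP => [/imsetP[w + ->]|/galeP[Sk uSv]].
    rewrite inE => /andP[/bruhat_leP uw /bruhat_leP wv].
    by apply/galeP; rewrite card_proj //; split=> // j; rewrite uw wv.
  apply: (gale_convex (k := k) (A := proj k u) (B := proj k v)) => //.
  - by move=> _ /imsetP[w _ ->]; apply: card_proj.
  - by move=> X Y e; apply: proj_exchange_in.
  - by move=> X Y e; apply: proj_exchange_out.
  - exact: (three_term_middle_closed gI uI kn closed).
  - exact: (three_term_co_middle_closed gI uI kn closed).
  - exact: imset_f.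
  - exact: imset_f.
have gI := gale_greedy huv gale.
split; first exact: greedy_generalized_permutahedron uI.
have closed : three_term_closed I u.
  apply: middle_closed_three_term => // k kn; rewrite (gale k kn).
  have [ku kv] : #|proj k u| = k /\ #|proj k v| = k by case/andP: kn => _ kn;
    rewrite !card_proj.
  split; [exact: gale_interval_middle_closed | exact: gale_interval_co_middle_closed].
by move=> S a b c aS bS cS abc; apply/(three_termP R uI); apply: closed.
Qed.
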